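(* Let $L^*$ be a real symmetric positive definite $N\times N$ matrix that is block diagonal with set of blocks $\mathcal P$ (a partition of $[N]$). Let $Z_1,Z_2,\dots$ be i.i.d. with law $\mathsf{DPP}(L^* )$ and let $\hat L=\hat L_n$ be the maximum likelihood estimator based on $Z_1,\dots,Z_n$. Then, for $J,J'\in\mathcal P$ with $J\ne J'$, $$\min_{D\in\mathcal D}\|\hat L_{J,J'}-DL^*_{J,J'}D\|_F=O_{\mathbb P}(n^{-1/6})$$ and $$\min_{D\in\mathcal D}\|\hat L_J-DL^*_JD\|_F=O_{\mathbb P}(n^{-1/2}).$$
   Context: Notation: $[N]=\{1,\dots,N\}$; $\mathcal S_{[N]}^{++}$ is the set of real symmetric positive definite $N\times N$ matrices; $\|\cdot\|_F$ is the Frobenius norm. $\mathcal D$ is the set of $N\times N$ diagonal matrices with diagonal entries $\pm1$. For $A\in\mathbb R^{N\times N}$ and $J,J'\subset[N]$, $A_{J,J'}$ is the $N\times N$ matrix whose $(i,j)$ entry is $A_{i,j}$ if $(i,j)\in J\times J'$ and $0$ otherwise; in the norms above $A_J$ is understood as $A_{J,J}$, while inside determinants $A_J$ is the principal submatrix indexed by $J$ (with $\det A_\emptyset=1$). Blocks: a symmetric matrix $A$ is block diagonal if there is a partition $\{J_1,\dots,J_k\}$ of $[N]$, $k\ge1$, with $A_{i,j}=0$ whenever $i\in J_a$, $j\in J_b$, $a\ne b$; the blocks of $A$ are the elements of such a partition with the largest possible $k$ (equivalently, the connected components of the graph on $[N]$ with edges $\{i,j\}$ such that $A_{i,j}\neq0$).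 For $L\in\mathcal S_{[N]}^{++}$, $\mathsf{DPP}(L)$ is the law of a random subset $Z\subset[N]$ with $\mathbb P[Z=J]=p_J(L)=\det(L_J)/\det(I+L)$ for all $J\subset[N]$. Maximum likelihood estimator: $\hat\Phi(L)=\frac1n\sum_{i=1}^n\log p_{Z_i}(L)$ for $L\in\mathcal S_{[N]}^{++}$; $\hat L$ is any random matrix that is a maximizer of $\hat\Phi$ over $\mathcal S_{[N]}^{++}$ (arbitrary on the event that no maximizer exists). $X_n=O_{\mathbb P}(r_n)$ means that the sequence $X_n/r_n$ is bounded in probability as $n\to\infty$. *)

(* Defs.v *)
From HB Require Import structures.
From mathcomp Require Import all_boot all_order all_algebra finmap.
From mathcomp Require Import all_classical all_reals all_analysis.
Import Order.TTheory GRing.Theory Num.Theory.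
Import numFieldNormedType.Exports.

Set Implicit Arguments.
Unset Strict Implicit.
Unset Printing Implicit Defensive.

Local Open Scope classical_set_scope.
Local Open Scope ring_scope.

Section Matrices.
Context {R : realType} {N : nat}.
Implicit Types (A L : 'M[R]_N) (J : {set 'I_N}) (P : {set {set 'I_N}}).

Definition posdefmx A : Prop :=
  A^T = A /\ forall v : 'cV[R]_N, v != 0 -> 0 < (v^T *m A *m v) 0 0.

Definition frobenius_norm A : R := Num.sqrt (\sum_i \sum_j A i j ^+ 2).

(* Same size as [A]: the entries outside [J * J'] are set to zero. *)
Definition restrict_mx J J' A : 'M[R]_N :=
  \matrix_(i, j) if (i \in J) && (j \in J') then A i j else 0.

Definition principal_submx J A : 'M[R]_#|J| :=
  mxsub (enum_val (A := J)) (enum_val (A := J)) A.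

Definition block_partition A P : Prop :=
  finset.partition P [set: 'I_N]%SET /\
  forall J J', J \in P -> J' \in P -> J != J' ->
    forall i j, i \in J -> j \in J' -> A i j = 0.

Definition blocks A P : Prop :=
  block_partition A P /\ forall Q, block_partition A Q -> (#|Q| <= #|P|)%N.

Definition sign_mx (s : {ffun 'I_N -> bool}) : 'M[R]_N :=
  diag_mx (\row_i (-1) ^+ s i).

Lemma sign_mxP A :
  (exists s, A = sign_mx s) <->
  is_diag_mx A /\ forall i, A i i = 1 \/ A i i = -1.
Proof.
split=> [[s ->]|[/is_diag_mxP dA A1]].
  split=> [|i]; first exact: diag_mx_is_diag.
  by rewrite !mxE eqxx mulr1n; case: (s i); [right|left].
exists [ffun i => A i i == -1]; apply/matrixP => i j; rewrite !mxE ffunE.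
case: (eqVneq i j) => [<-|ij]; last by rewrite mulr0n dA.
rewrite mulr1n; case: (A1 i) => ->; last by rewrite eqxx.
by rewrite -subr_eq0 opprK -(natrD _ 1 1) pnatr_eq0.
Qed.

(* The minimum of ||A - D B D||_F over the diagonal sign matrices [D]; the
   default value of the iterated minimum is the term for [D = I]. *)
Definition sign_dist A B : R :=
  let F s := frobenius_norm (A - sign_mx s *m B *m sign_mx s) in
  \big[Num.min/F [ffun=> false]]_(s : {ffun 'I_N -> bool}) F s.

Definition dpp_prob L J : R := \det (principal_submx J L) / \det (1%:M + L).

(* The sample is [z 0, ..., z (n - 1)]. *)
Definition log_likelihood (z : nat -> {set 'I_N}) (n : nat) L : R :=
  n%:R^-1 * \sum_(i < n) ln (dpp_prob L (z i)).

Definition is_mle (z : nat -> {set 'I_N}) (n : nat) L : Prop :=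
  posdefmx L /\
  forall L', posdefmx L' -> log_likelihood z n L' <= log_likelihood z n L.

End Matrices.

Section Probability.
Context {R : realType} {d : measure_display} {T : measurableType d}.
Variable P : probability T R.

(* A random element of a finite type is measurable when the preimage of each
   singleton is. *)
Definition has_dpp_law (N : nat) (L : 'M[R]_N) (Z : T -> {set 'I_N}) : Prop :=
  forall J : {set 'I_N},
    measurable (Z @^-1` [set J]) /\ P (Z @^-1` [set J]) = (dpp_prob L J)%:E.

(* For random elements of a finite type, every set of values is an event. *)
Definition mutually_independent (U : finType) (Z : nat -> T -> U) : Prop :=
  forall (I : {fset nat}) (A : nat -> set U),
    P (\bigcap_(i in [set` I]) (Z i @^-1` A i)) =
    (\prod_(i <- I) P (Z i @^-1` A i))%E.

Definition is_Op (X : nat -> T -> R) (r : nat -> R) : Prop :=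
  forall eps : R, 0 < eps ->
    exists2 M : R, 0 < M &
      \forall n \near \oo, (P [set w | (M < `|X n w / r n|)%R] <= eps%:E)%E.

End Probability.

(* Main.v *)
Require Import Defs.
From HB Require Import structures.
From mathcomp Require Import all_boot all_order all_algebra finmap.
From mathcomp Require Import all_classical all_reals all_analysis.
From mathcomp Require Import perm measurable_realfun zify ring lra.
Import Order.TTheory GRing.Theory Num.Theory.
Import numFieldNormedType.Exports.

Set Implicit Arguments.
Unset Strict Implicit.
Unset Printing Implicit Defensive.

Local Open Scope classical_set_scope.
Local Open Scope ring_scope.

(* The empirical frequencies are within [O(n^-1/2)] of the law [p*] by
   Chebyshev's inequality.  Once both extreme subsets have been observed, a
   maximum likelihood estimator exists by compactness, and comparing the two
   Kullback-Leibler divergences of the frequencies from [p(Lhat)] and from [p*]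
   shows that [p(Lhat)], hence every principal minor of [Lhat], is within
   [delta = O(n^-1/2)] of its value at [L*].

   The rest is a deterministic stability estimate for the principal minor map.
   Between two blocks, [Lhat_ij ^ 2 = Lhat_ii Lhat_jj - det Lhat_{ij}] is
   [O(delta)], which gives the rate [n^-1/4], better than [n^-1/6].  A block is
   recovered, up to signs, by adding one vertex [v] at a time to a set [S] that
   is connected in the graph of [L*]: the bordered minors determine all the
   products [Lhat_vi Lhat_vj] with [i, j] in [S] up to [O(delta)], by induction
   on the distance from [i] to [j], hence the vector [(Lhat_vi)_i] up to a
   global sign. *)

(** * Determinants and positive definite matrices *)

(** Sylvester's identity: the block matrix with rows [(1, -U)] and [(V, 1)] factors in two ways into
    block triangular matrices, each leaving one of the two determinants. *)
Lemma det_add1_mulmxC (F : comNzRingType) m n (U : 'M[F]_(m, n))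
    (V : 'M[F]_(n, m)) :
  \det (1%:M + U *m V) = \det (1%:M + V *m U).
Proof.
have E1 : block_mx 1%:M (- U) V 1%:M =
    block_mx 1%:M 0 V 1%:M *m block_mx 1%:M (- U) 0 (1%:M + V *m U).
  rewrite mulmx_block !(mul1mx, mul0mx, mulmx1, addr0, mulmxN).
  by rewrite addrCA addNr addr0.
have E2 : block_mx 1%:M (- U) V 1%:M =
    block_mx 1%:M (- U) 0 1%:M *m block_mx (1%:M + U *m V) 0 V 1%:M.
  by rewrite mulmx_block !(mul1mx, mul0mx, mulmx1, add0r, mulNmx) addrK.
move: E1; rewrite E2 => /(congr1 determinant).
by rewrite !det_mulmx !det_ublock !det_lblock !det1 !mulr1 !mul1r.
Qed.

(** In the Leibniz formula each factor is a sum of two terms; expanding the product, [J] collects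
    the rows where the term of [A] is chosen. *)
Lemma det_add1_sum (F : comNzRingType) n (A : 'M[F]_n) :
  \det (1%:M + A) = \sum_(J : {set 'I_n})
    \det (\matrix_(i, j) if i \in J then A i j else (i == j)%:R).
Proof.
rewrite /determinant exchange_big /=; apply: eq_bigr => s _.
rewrite -mulr_sumr; congr (_ * _).
under eq_bigr do rewrite !mxE addrC.
by rewrite bigA_distr; under [RHS]eq_bigr do under eq_bigr do rewrite !mxE.
Qed.

Lemma mxsub_mulmx (F : nzSemiRingType) m n (f : 'I_m -> 'I_n) (A : 'M[F]_n) :
  mxsub f f A = rowsub f 1%:M *m A *m (rowsub f 1%:M)^T.
Proof.
rewrite -rowsubE; apply/matrixP => i j; rewrite !mxE.
rewrite (bigD1 (f j)) //= !mxE eqxx mulr1 big1 ?addr0 // => k kj.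
by rewrite !mxE eq_sym (negbTE kj) mulr0.
Qed.

Lemma rowsub1_mulmx_tr (F : nzSemiRingType) m n (f : 'I_m -> 'I_n) :
  injective f -> rowsub f 1%:M *m (rowsub f (1%:M : 'M[F]_n))^T = 1%:M.
Proof.
move=> fI; rewrite -[X in X *m _]mulmx1 -mxsub_mulmx; apply/matrixP => i j.
by rewrite !mxE (inj_eq fI).
Qed.

(** The left-hand matrix keeps the size [n] whatever [J] is. It equals [1 + E^T (E (A - 1))] for the
    matrix [E] selecting the rows in [J], and Sylvester's identity turns its determinant into that
    of [E A E^T]. *)
Lemma det_fill_identity (R : realType) n (J : {set 'I_n}) (A : 'M[R]_n) :
  \det (\matrix_(i, j) if i \in J then A i j else (i == j)%:R) =
  \det (principal_submx J A).
Proof.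
set f := enum_val (A := J); set E : 'M[R]__ := rowsub f 1%:M.
have -> : (\matrix_(i, j) if i \in J then A i j else (i == j)%:R) =
    1%:M + E^T *m (E *m (A - 1%:M)).
  apply/matrixP => i j; rewrite /E -rowsubE !mxE.
  case: ifPn => iJ; last first.
    rewrite big1 ?addr0// => k _; rewrite !mxE.
    case: eqP => [ki|]; last by rewrite mul0r.
    by rewrite -ki /f enum_valP in iJ.
  rewrite (bigD1 (enum_rank_in iJ i)) //= !mxE /f enum_rankK_in // eqxx mul1r.
  rewrite big1 => [|k kJ]; first by rewrite addr0 addrCA subrr addr0.
  rewrite !mxE.
  case: eqP => [ki|]; last by rewrite mul0r.
  by case/eqP: kJ; apply: enum_val_inj; rewrite enum_rankK_in.
rewrite det_add1_mulmxC mulmxBr mulmx1 mulmxBl -mxsub_mulmx.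
rewrite rowsub1_mulmx_tr; last exact: enum_val_inj.
by rewrite addrCA subrr addr0.
Qed.

Lemma det_add1_sum_principal (R : realType) n (A : 'M[R]_n) :
  \det (1%:M + A) = \sum_(J : {set 'I_n}) \det (principal_submx J A).
Proof. by rewrite det_add1_sum; under eq_bigr do rewrite det_fill_identity. Qed.

(** The injection [f] and the enumeration of its image differ by one permutation, applied to both
    rows and columns, so the two signs cancel. *)
Lemma det_mxsub_inj (R : realType) m n (f : 'I_m -> 'I_n) (A : 'M[R]_n) :
  injective f ->
  \det (mxsub f f A) = \det (principal_submx [set f k | k : 'I_m] A).
Proof.
move=> fI; set J := [set f k | k : 'I_m].
have mJ : m = #|J| by rewrite card_imset // card_ord.
have fJ k : f k \in J by apply/imsetP; exists k.
(* Forgetting how [J] was built allows [m] to be replaced by [#|J|], which gives both matrices the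
   same type. *)
move: J mJ fJ => J mJ; subst m => fJ.
have gI : injective (fun k => enum_rank_in (fJ k) (f k)).
  move=> k l /(congr1 enum_val) kl; apply: fI.
  by move: kl; rewrite !enum_rankK_in.
have -> : mxsub f f A =
    row_perm (perm gI) (col_perm (perm gI) (principal_submx J A)).
  by apply/matrixP => k l; rewrite !mxE !permE !enum_rankK_in.
rewrite row_permE col_permE !det_mulmx !det_perm odd_permV mulrCA.
by rewrite -signr_addb addbb mulr1.
Qed.

Section Schur.
Variables (F : fieldType) (n : nat).
Variables (a : 'M[F]_1) (r : 'rV[F]_n) (b : 'cV[F]_n) (C : 'M[F]_n).
Hypothesis Cu : C \in unitmx.

Lemma det_schur :
  \det (block_mx a r b C) = (a - r *m invmx C *m b) 0 0 * \det C.
Proof.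
have -> : block_mx a r b C = block_mx 1%:M (r *m invmx C) 0 1%:M *m
    block_mx (a - r *m invmx C *m b) 0 b C.
  rewrite mulmx_block !(mul1mx, mul0mx, add0r) subrK.
  by rewrite -mulmxA mulVmx // mulmx1.
by rewrite det_mulmx det_ublock det_lblock !det1 !mul1r det_mx11.
Qed.

(** With the adjugate in place of the inverse, the coefficients of the quadratic form in the border
    are polynomials in the entries of [C], hence stable under approximation. *)
Lemma det_bordered :
  \det (block_mx a r b C) = a 0 0 * \det C - (r *m \adj C *m b) 0 0.
Proof.
rewrite det_schur.
have -> : r *m \adj C *m b = \det C *: (r *m invmx C *m b).
  rewrite /invmx Cu -!scalemxAr -!scalemxAl scalerA divff ?scale1r //.
  by rewrite -unitfE -unitmxE.
by rewrite !mxE mulrBl [X in _ = _ - X]mulrC.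
Qed.
End Schur.

Lemma posdefmx_mxsub (R : realType) m n (f : 'I_m -> 'I_n) (A : 'M[R]_n) :
  injective f -> posdefmx A -> posdefmx (mxsub f f A).
Proof.
move=> fI [At Ap]; split.
  by apply/matrixP => i j; rewrite !mxE -{1}At mxE.
move=> v v0; rewrite mxsub_mulmx; set E := rowsub f _.
have -> : v^T *m (E *m A *m E^T) *m v = (E^T *m v)^T *m A *m (E^T *m v).
  by rewrite trmx_mul trmxK !mulmxA.
apply: Ap; apply: contra_neq v0 => /(congr1 (mulmx E)).
by rewrite mulmxA rowsub1_mulmx_tr // mul1mx mulmx0.
Qed.

(** Induction on the size: the Schur complement of the lower right block is the value of the
    quadratic form at the nonzero vector [v] for which the lower part of [A v] vanishes. *)
Lemma posdefmx_det_gt0 (R : realType) n (A : 'M[R]_n) :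
  posdefmx A -> 0 < \det A.
Proof.
elim: n A => [|n IH] A; first by rewrite det_mx00.
rewrite -[n.+1]/(1 + n)%N in A * => Ap.
have Cp : posdefmx (drsubmx A).
  have -> : drsubmx A = mxsub (@rshift 1 n) (@rshift 1 n) A.
    by apply/matrixP => i j; rewrite !mxE.
  by apply: posdefmx_mxsub => //; exact: (@rshift_inj 1 n).
have Cd := IH _ Cp.
have Cu : drsubmx A \in unitmx by rewrite unitmxE unitfE gt_eqF.
rewrite -(submxK A) det_schur // mulr_gt0 //.
case: Ap => At /(_ (col_mx 1%:M (- (invmx (drsubmx A) *m dlsubmx A)))).
set v := col_mx _ _ => /(_ _)/wrap[].
  apply/eqP => /(congr1 usubmx); rewrite col_mxKu => /matrixP/(_ 0 0).
  by rewrite !mxE/= => /eqP; rewrite mulr1n oner_eq0.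
rewrite -mulmxA -{1}(submxK A) mul_block_col !mulmx1 mulmxN mulmxA mulmxN.
rewrite mulmxA mulmxV // mul1mx subrr tr_col_mx mul_row_col mulmx0 addr0.
by rewrite trmx1 mul1mx.
Qed.

(** * Stability of the principal minor map *)

Section Approx.
Variables (R : realType) (I : Type) (delta : I -> R).
Hypothesis delta01 : forall w, 0 <= delta w <= 1.
Implicit Types (x y : I -> R) (a b : R).

Definition approxO x a := exists C, forall w, `|x w - a| <= C * delta w.
Definition bounded_family x := exists C, forall w, `|x w| <= C.

Lemma eq_approx x y a : (forall w, x w = y w) -> approxO x a -> approxO y a.
Proof. by move=> xy [C xC]; exists C => w; rewrite -xy. Qed.

Lemma approx_cst a : approxO (fun=> a) a.
Proof. by exists 0 => w; rewrite subrr normr0 mul0r. Qed.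

Lemma approx_bounded x a : approxO x a -> bounded_family x.
Proof.
case=> C xC; exists (`|C| + `|a|) => w; have /andP[d0 d1] := delta01 w.
rewrite -[x w](subrK a) (le_trans (ler_normD _ _)) // lerD2r.
rewrite (le_trans (xC w)) // (le_trans (ler_norm _)) // normrM.
by rewrite ler_piMr // ger0_norm.
Qed.

Lemma approxD x y a b :
  approxO x a -> approxO y b -> approxO (fun w => x w + y w) (a + b).
Proof.
move=> [C xC] [D yD]; exists (C + D) => w.
by rewrite opprD addrACA mulrDl (le_trans (ler_normD _ _)) // lerD.
Qed.

Lemma approx0M x y : approxO x 0 -> bounded_family y ->
  approxO (fun w => x w * y w) 0.
Proof.
move=> [C xC] [D yD]; exists (C * D) => w.
rewrite subr0 normrM mulrAC ler_pM //; first by rewrite -[x w]subr0.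
Qed.

Lemma approxMl x a b : approxO x a -> approxO (fun w => b * x w) (b * a).
Proof.
move=> [C xC]; exists (`|b| * C) => w.
by rewrite -mulrBr normrM -mulrA ler_wpM2l.
Qed.

Lemma approxB x y a b :
  approxO x a -> approxO y b -> approxO (fun w => x w - y w) (a - b).
Proof.
move=> xa /(approxMl (-1)); rewrite mulN1r => yb.
by apply: eq_approx (approxD xa yb) => w; rewrite mulN1r.
Qed.

Lemma approx_sub0 x a : approxO (fun w => x w - a) 0 <-> approxO x a.
Proof. by split=> -[C xC]; exists C => w; move: (xC w); rewrite subr0. Qed.

Lemma approxM x y a b :
  approxO x a -> approxO y b -> approxO (fun w => x w * y w) (a * b).
Proof.
move=> xa yb; have /(approxMl a) ayb := yb.
have yB := approx_bounded yb; move/approx_sub0 : xa => xa.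
rewrite -[a * b]add0r; apply: eq_approx (approxD (approx0M xa yB) ayb) => w.
by rewrite mulrBl subrK.
Qed.

Lemma approx_sum (K : Type) (r : seq K) (p : pred K) (x : K -> I -> R)
    (a : K -> R) :
  (forall k, p k -> approxO (x k) (a k)) ->
  approxO (fun w => \sum_(k <- r | p k) x k w) (\sum_(k <- r | p k) a k).
Proof.
move=> xa; elim: r => [|k r IH].
  by rewrite big_nil; apply: eq_approx (approx_cst 0) => w; rewrite big_nil.
rewrite big_cons; case: ifPn => pk.
  by apply: eq_approx (approxD (xa k pk) IH) => w; rewrite big_cons pk.
by apply: eq_approx IH => w; rewrite big_cons (negbTE pk).
Qed.

Lemma approx_prod (K : Type) (r : seq K) (x : K -> I -> R) (a : K -> R) :
  (forall k, approxO (x k) (a k)) ->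
  approxO (fun w => \prod_(k <- r) x k w) (\prod_(k <- r) a k).
Proof.
move=> xa; elim: r => [|k r IH].
  by rewrite big_nil; apply: eq_approx (approx_cst 1) => w; rewrite big_nil.
rewrite big_cons; apply: eq_approx (approxM (xa k) IH) => w.
by rewrite big_cons.
Qed.

Lemma approx_det n (M : I -> 'M[R]_n) (A : 'M[R]_n) :
  (forall i j, approxO (fun w => M w i j) (A i j)) ->
  approxO (fun w => \det (M w)) (\det A).
Proof.
move=> MA; apply: approx_sum => s _; apply: approxMl.
by apply: approx_prod => i; exact: MA.
Qed.

Lemma bounded_sqr x a : approxO (fun w => x w * x w) a -> bounded_family x.
Proof.
move=> /approx_bounded[C xC]; exists (1 + C) => w; move: (xC w).
rewrite normrM => xwC; have [x1|x1] := leP `|x w| 1.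
  by rewrite (le_trans x1) // lerDl (le_trans _ xwC) // mulr_ge0.
by rewrite (le_trans (ler_peMl _ (ltW x1))) // (le_trans xwC) // lerDr.
Qed.

Lemma bounded_familyM x y : bounded_family x -> bounded_family y ->
  bounded_family (fun w => x w * y w).
Proof.
by move=> [C xC] [D yD]; exists (C * D) => w; rewrite normrM ler_pM.
Qed.

Lemma approx_divl x a b : b != 0 -> approxO (fun w => b * x w) (b * a) ->
  approxO x a.
Proof.
move=> b0 /(approxMl b^-1); rewrite mulKf //.
by apply: eq_approx => w; rewrite mulKf.
Qed.

(* [|x - s a| |x + s a| = O(delta)] and the second factor is at least [|a|]
   when [s] is the sign of [a x]. *)
Lemma approx_sqr_sign x a : a != 0 -> approxO (fun w => x w * x w) (a * a) ->
  exists s : I -> bool, approxO (fun w => (-1) ^+ s w * x w) a.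
Proof.
move=> a0 [C xC]; exists (fun w => x w * a < 0); exists (C / `|a|) => w.
rewrite mulrAC ler_pdivlMr ?normr_gt0 //; apply: le_trans (xC w).
set y := (-1) ^+ _ * x w; have yx : x w * x w = y * y.
  by rewrite /y mulrACA -signr_addb addbb mul1r.
have ya : 0 <= y * a.
  rewrite /y -mulrA; case: ltP => h; last by rewrite expr0 mul1r.
  by rewrite expr1 mulN1r oppr_ge0 ltW.
rewrite yx (_ : y * y - a * a = (y - a) * (y + a)); last by ring.
rewrite normrM ler_wpM2l // -ler_sqr ?nnegrE // !real_normK ?num_real //.
by rewrite sqrrD; have := sqr_ge0 y; lra.
Qed.

Lemma approx_norm x a : approxO x a -> approxO (fun w => `|x w - a|) 0.
Proof. by move=> [C xC]; exists C => w; rewrite subr0 normr_id. Qed.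
End Approx.

(** * Walks in the graph of a symmetric matrix *)

Section Walks.
Variables (R : realType) (N : nat) (A : 'M[R]_N) (S : {set 'I_N}).
Hypothesis At : A^T = A.

(** A walk is a function on all of [nat], of which only the values up to [m] matter, so that
    concatenation and reversal are index arithmetic. *)
Definition walk m i j := exists f : nat -> 'I_N,
  [/\ f 0%N = i, f m = j, forall k, (k <= m)%N -> f k \in S &
    forall k, (k < m)%N -> A (f k) (f k.+1) != 0].

Lemma walk_cat m n i k j : walk m i k -> walk n k j -> walk (m + n) i j.
Proof.
move=> [f [f0 fm fS fA]] [g [g0 gn gS gA]].
exists (fun t => if (t <= m)%N then f t else g (t - m)%N); split => //.
- rewrite -[X in (_ <= X)%N]addn0 leq_add2l leqn0.
  case: eqVneq => [n0|_]; first by rewrite n0 addn0 fm -gn n0 g0.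
  by rewrite addKn.
- move=> t tmn; case: leqP => tm; first exact: fS.
  by apply: gS; rewrite leq_subLR.
- move=> t tmn; case: (ltngtP t m) => tm.
  + exact: fA.
  + rewrite subSn; last exact: ltnW.
    by apply: gA; rewrite ltn_subLR //; exact: ltnW.
  + have n0 : (0 < n)%N by rewrite -[n](addKn m) subn_gt0 -{1}tm.
    by rewrite tm fm -g0 subSnn; exact: gA.
Qed.

Lemma walk_sub m (f : nat -> 'I_N) a b :
  (forall k, (k <= m)%N -> f k \in S) ->
  (forall k, (k < m)%N -> A (f k) (f k.+1) != 0) ->
  (a <= b <= m)%N -> walk (b - a) (f a) (f b).
Proof.
move=> fS fA /andP[ab bm]; exists (fun t => f (a + t)%N); split.
- by rewrite addn0.
- by rewrite subnKC.
- move=> k kab; apply: fS; rewrite (leq_trans _ bm) //.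
  by rewrite -(subnKC ab) leq_add2l.
- move=> k kab; rewrite addnS; apply: fA; rewrite (leq_trans _ bm) //.
  by rewrite -(subnKC ab) ltn_add2l.
Qed.

Lemma walk_sym m i j : walk m i j -> walk m j i.
Proof.
move=> [f [f0 fm fS fA]]; exists (fun t => f (m - t)%N); split => //.
- by rewrite subn0.
- by rewrite subnn.
- by move=> k _; apply: fS; rewrite leq_subr.
- move=> k km; rewrite -At mxE -(subnSK km).
  by apply: fA; rewrite subnSK // leq_subr.
Qed.
End Walks.

(** Deleting the last row and the first column of this lower Hessenberg matrix leaves a lower
    triangular one, whose diagonal is the superdiagonal of [C]. *)
Lemma adj_path_neq0 (F : fieldType) m (C : 'M[F]_m.+1) :
  (forall k l : 'I_m.+1, l = k.+1 :> nat -> C k l != 0) ->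
  (forall k l : 'I_m.+1, (k.+1 < l)%N -> C k l = 0) ->
  \adj C 0 ord_max != 0.
Proof.
move=> Cneq0 C0; rewrite mxE /cofactor mulf_neq0 ?signr_eq0 //.
rewrite det_trig; last first.
  apply/is_trig_mxP => a b ab; rewrite !mxE; apply: C0.
  by rewrite lift_max lift0.
apply/prodf_neq0 => k _; rewrite !mxE; apply: Cneq0.
by rewrite lift_max lift0.
Qed.

Definition border N m (v : 'I_N) (f : 'I_m -> 'I_N) (k : 'I_(1 + m)) : 'I_N :=
  if fintype.split k is inr l then f l else v.

Lemma border_inj N m (v : 'I_N) (f : 'I_m -> 'I_N) :
  injective f -> (forall k, f k != v) -> injective (border v f).
Proof.
move=> fI fv k l kl; apply: (can_inj splitK); move: kl; rewrite /border.
case: (fintype.split k) (fintype.split l) => [a|a] [b|b] //=.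
- by rewrite (ord1 a) (ord1 b).
- by move=> /eqP; rewrite eq_sym (negbTE (fv _)).
- by move=> /eqP; rewrite (negbTE (fv _)).
- by move=> /fI ->.
Qed.

(** The quadratic form is written as one sum over pairs, so that its two corner terms can later be
    split off by a predicate. *)
Lemma det_mxsub_border (F : fieldType) N m (v : 'I_N) (f : 'I_m -> 'I_N)
    (M : 'M[F]_N) :
  M^T = M -> \det (mxsub f f M) != 0 ->
  \det (mxsub (border v f) (border v f) M) = M v v * \det (mxsub f f M) -
    \sum_(p : 'I_m * 'I_m)
      \adj (mxsub f f M) p.1 p.2 * (M v (f p.1) * M v (f p.2)).
Proof.
move=> Mt Md.
have -> : mxsub (border v f) (border v f) M = block_mx (M v v)%:M
    (\row_k M v (f k)) (\col_k M v (f k)) (mxsub f f M).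
  apply/matrixP => k l; rewrite !mxE /border.
  case: (fintype.split k) => a; rewrite !mxE;
    case: (fintype.split l) => b; rewrite !mxE //.
    by rewrite !ord1 eqxx mulr1n.
  by rewrite -{1}Mt mxE.
rewrite det_bordered; last by rewrite unitmxE unitfE.
rewrite mxE eqxx mulr1n mxE; congr (_ - _).
rewrite -(pair_bigA _ (fun k l =>
  \adj (mxsub f f M) k l * (M v (f k) * M v (f l)))) /= exchange_big /=.
apply: eq_bigr => l _; rewrite !mxE mulr_suml; apply: eq_bigr => k _.
by rewrite !mxE; ring.
Qed.

Lemma const1_inj (T : Type) (x : T) : injective (fun _ : 'I_1 => x).
Proof. by move=> a b _; rewrite !ord1. Qed.

Lemma det_mxsub_const1 (F : comNzRingType) N (i : 'I_N) (M : 'M[F]_N) :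
  \det (mxsub (fun _ : 'I_1 => i) (fun _ : 'I_1 => i) M) = M i i.
Proof. by rewrite det_mx11 mxE. Qed.

Lemma det_mxsub_pair (F : fieldType) N (i j : 'I_N) (M : 'M[F]_N) :
  M^T = M -> M j j != 0 ->
  let f := border i (fun _ : 'I_1 => j) in
  \det (mxsub f f M) = M i i * M j j - M i j * M i j.
Proof.
move=> Mt Mj f; rewrite det_mxsub_border // ?det_mxsub_const1 //.
congr (_ - _); rewrite -(pair_bigA _ (fun k l =>
  \adj (mxsub (fun=> j) (fun=> j) M) k l * (M i j * M i j))) /=.
rewrite !big_ord1 mxE /cofactor det_mx00 addn0 expr0 !mul1r //.
Qed.

(** * Recovering entries, up to signs, from principal minors *)

Section MinorsDetermine.
Variables (R : realType) (N : nat) (I : Type) (delta : I -> R).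
Hypothesis delta01 : forall w, 0 <= delta w <= 1.
Variable A : 'M[R]_N.
Hypothesis At : A^T = A.

(** All three conditions are invariant under conjugation by sign matrices, so the family can be
    replaced by a conjugate one during the induction. *)
Definition minors_approx (L : I -> 'M[R]_N) :=
  [/\ forall w, (L w)^T = L w,
      forall w m (f : 'I_m -> 'I_N), injective f ->
        \det (mxsub f f (L w)) != 0 &
      forall m (f : 'I_m -> 'I_N), injective f ->
        approxO delta (fun w => \det (mxsub f f (L w))) (\det (mxsub f f A))].

Hypothesis Adet : forall m (f : 'I_m -> 'I_N), injective f ->
  \det (mxsub f f A) != 0.

Definition walk_connected (S : {set 'I_N}) := forall i j, i \in S -> j \in S ->
  exists m, walk A S m i j.

Section Entries.
Variable L : I -> 'M[R]_N.
Hypothesis LA : minors_approx L.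

Lemma approx_diag i : approxO delta (fun w => L w i i) (A i i).
Proof.
case: LA => _ _ /(_ _ _ (@const1_inj _ i)); rewrite det_mxsub_const1.
by apply: eq_approx => w; rewrite det_mxsub_const1.
Qed.

Lemma approx_offdiag_sqr i j :
  approxO delta (fun w => L w i j * L w i j) (A i j * A i j).
Proof.
have [<-|ij] := eqVneq i j.
  by apply: approxM => //; exact: approx_diag.
case: LA => Lt Ldet.
have Lj w : L w j j != 0.
  by rewrite -det_mxsub_const1 Ldet //; exact: const1_inj.
have Aj : A j j != 0 by rewrite -det_mxsub_const1 Adet //; exact: const1_inj.
have bI : injective (border i (fun _ : 'I_1 => j)).
  by apply: border_inj => [|_]; [exact: const1_inj|rewrite eq_sym].
move=> /(_ _ _ bI); rewrite det_mxsub_pair // => LAij.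
have := approxB (approxM delta01 (approx_diag i) (approx_diag j)) LAij.
rewrite opprB addrC subrK; apply: eq_approx => w.
by rewrite det_mxsub_pair // opprB addrC subrK.
Qed.

Lemma bounded_entry i j : bounded_family (fun w => L w i j).
Proof. exact: bounded_sqr (approx_offdiag_sqr i j). Qed.

Section Extend.
Variables (S : {set 'I_N}) (v : 'I_N).
Hypothesis vS : v \notin S.
Hypothesis LS : forall i j, i \in S -> j \in S ->
  approxO delta (fun w => L w i j) (A i j).

(* Induction on the length of a shortest walk [f] from [i] to [j].  Expanding
   the minor of [v :: f] along [v] leaves the quadratic form of the adjugate of
   the minor of [f]; a shortest walk is an induced path, so the corner entry of
   this adjugate is the product of the edges of the path. *)
Lemma approx_border_products m i j : walk A S m i j ->
  approxO delta (fun w => L w v i * L w v j) (A v i * A v j).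
Proof.
elim/ltn_ind: m i j => m IH i j wij.
have [[m' m'm wm']|short] :=
    pselect (exists2 m', (m' < m)%N & walk A S m' i j).
  exact: IH wm'.
have {}short m' : walk A S m' i j -> (m <= m')%N.
  by move=> w'; rewrite leqNgt; apply/negP => m'm; apply: short; exists m'.
have [f [f0 fm fS fA]] := wij.
have sub a b : (a <= b <= m)%N -> walk A S (b - a) (f a) (f b).
  exact: walk_sub.
(* A chord from [f a] to [f b] would give a walk of length [a + 1 + (m - b) < m]. *)
have induced a b : (b <= m)%N -> (a.+1 < b)%N -> A (f a) (f b) = 0.
  move=> bm ab; apply/eqP; apply: contraT => fab.
  have am : (a < m)%N by rewrite (leq_trans _ bm) // ltnW.
  have w1 : walk A S 1 (f a) (f b).
    exists (fun k => if k is 0 then f a else f b); split => //.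
      by case=> [|k] _; apply: fS => //; exact: ltnW.
    by case.
  have := walk_cat (walk_cat (sub 0%N a (ltnW am)) w1)
    (sub b m _); rewrite bm leqnn f0 fm => /(_ isT)/short.
  by rewrite subn0 leqNgt; case/negP; lia.
(* Cutting out a loop at a repeated vertex would give a walk of length [a + (m - b) < m]. *)
have inj_f a b : (a < b <= m)%N -> f a != f b.
  move=> /andP[ab bm]; apply/eqP => fab.
  have am : (a <= m)%N by rewrite (leq_trans _ bm) // ltnW.
  have wa := sub 0%N a am; rewrite fab in wa.
  have := walk_cat wa (sub b m _); rewrite bm leqnn f0 fm => /(_ isT)/short.
  by rewrite subn0 leqNgt; case/negP; lia.
pose F (k : 'I_m.+1) := f k.
have FS k : F k \in S by apply: fS; rewrite -ltnS.
have FI : injective F.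
  move=> a b Fab; apply: val_inj; case: (ltngtP a b) => // ab.
    by have := inj_f a b; rewrite ab -ltnS ltn_ord => /(_ isT)/eqP/(_ Fab).
  by have := inj_f b a; rewrite ab -ltnS ltn_ord => /(_ isT)/eqP/(_ (esym Fab)).
have bI : injective (border v F).
  by apply: border_inj => // k; apply: contraNneq vS => <-.
case: (LA) => Lt Ldet LAdet.
pose t k l w := L w v (F k) * L w v (F l) - A v (F k) * A v (F l).
pose aA := \adj (mxsub F F A).
have tB k l : bounded_family (fun w => L w v (F k) * L w v (F l)).
  by apply: bounded_familyM; exact: bounded_entry.
(* Both sums are a diagonal entry times the minor of [F], minus the bordered minor; all three
   quantities are approximated. *)
have step1 : approxO delta (fun w => \sum_(p : 'I_m.+1 * 'I_m.+1)
    \adj (mxsub F F (L w)) p.1 p.2 * (L w v (F p.1) * L w v (F p.2)))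
    (\sum_(p : 'I_m.+1 * 'I_m.+1) aA p.1 p.2 * (A v (F p.1) * A v (F p.2))).
  have := approxB (approxM delta01 (approx_diag v) (LAdet _ _ FI))
    (LAdet _ _ bI).
  rewrite (det_mxsub_border _ At) ?Adet // opprB addrC subrK.
  apply: eq_approx => w.
  by rewrite (det_mxsub_border _ (Lt w)) ?Ldet // opprB addrC subrK.
(* The adjugates may be exchanged at cost [O(delta)]: their entries are polynomials in entries
   indexed by [S], covered by [LS], and the products they multiply are bounded. *)
have step2 : approxO delta (fun w => \sum_(p : 'I_m.+1 * 'I_m.+1)
    aA p.1 p.2 * t p.1 p.2 w) 0.
  have d p : approxO delta (fun w =>
     (\adj (mxsub F F (L w)) p.1 p.2 - aA p.1 p.2) *
       (L w v (F p.1) * L w v (F p.2))) 0.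
    apply: approx0M (tB _ _); apply/approx_sub0; rewrite /aA mxE.
    apply: (@eq_approx _ _ _ (fun w => cofactor (mxsub F F (L w)) p.2 p.1)).
      by move=> w; rewrite [RHS]mxE.
    apply/approxMl/approx_det => // a b; rewrite !mxE.
    by apply: eq_approx (LS (FS _) (FS _)) => w; rewrite !mxE.
  have := approx_sum (index_enum _) (fun p (_ : true) => d p).
  rewrite big1 // => /(approxB step1); rewrite subr0 => /approx_sub0.
  apply: eq_approx => w.
  rewrite -!sumrB; apply: eq_bigr => p _; rewrite /t; ring.
(* The two corners, which coincide when [m = 0]. *)
pose ext (p : 'I_m.+1 * 'I_m.+1) :=
  (p == (ord0, ord_max)) || (p == (ord_max, ord0)).
have step3 : approxO delta (fun w => \sum_(p | ext p) aA p.1 p.2 * t p.1 p.2 w)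
    0.
  have : approxO delta (fun w => \sum_(p | ~~ ext p) aA p.1 p.2 * t p.1 p.2 w)
      (\sum_(p : 'I_m.+1 * 'I_m.+1 | ~~ ext p) 0).
    apply: approx_sum => -[k l] /= kl; rewrite -(mulr0 (aA k l)).
    apply/approxMl/approx_sub0.
    wlog kl' : k l kl / (k <= l)%N.
      move=> H; case: (leqP k l) => [|/ltnW] lk; first exact: H.
      have := H l k; rewrite mulrC => h.
      apply: eq_approx (h _ lk) => [w|]; first by rewrite mulrC.
      apply: contra kl; rewrite /ext => /orP[]/eqP[-> ->].
        by rewrite eqxx orbT.
      by rewrite eqxx.
    (* Away from the corners, [F k] and [F l] are joined by a piece of [f] shorter than [m]. *)
    apply: (IH (l - k)%N); last first.
      by apply: sub; rewrite kl' -ltnS ltn_ord.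
    rewrite ltnNge; apply: contra kl => mlk.
    have lm := ltn_ord l; rewrite /ext; apply/orP; left; apply/eqP.
    by congr (_, _); apply: val_inj => /=; lia.
  rewrite big1 // => /(approxB step2); rewrite subr0.
  apply: eq_approx => w; rewrite [X in X - _](bigID ext) /=.
  by rewrite addrK.
have aAt k l : aA k l = aA l k.
  rewrite /aA -[in LHS](trmxK (mxsub F F A)) -trmx_adj mxE.
  suff -> : (mxsub F F A)^T = mxsub F F A by [].
  by apply/matrixP => a b; rewrite !mxE -{1}At mxE.
(* By symmetry of the adjugate the corner terms are equal; their number, one or two, only has to be
   nonzero. *)
have {step3} : approxO delta
    (fun w => (aA ord0 ord_max *+ #|ext|) * t ord0 ord_max w) 0.
  apply: eq_approx step3 => w; rewrite mulrnAl -sumr_const.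
  apply: eq_bigr => p /orP[]/eqP->//=.
  by rewrite aAt /t; ring.
rewrite -(mulr0 (aA ord0 ord_max *+ #|ext|)) => /approx_divl.
rewrite /t /F /= f0 fm => h; apply/approx_sub0/h.
rewrite mulrn_eq0 negb_or; apply/andP; split.
  by apply/eqP => /card0_eq/(_ (ord0, ord_max)); rewrite unfold_in /ext eqxx.
apply: adj_path_neq0 => k l; rewrite mxE /F => kl.
  by rewrite kl; apply: fA; rewrite -ltnS -kl.
by apply: induced => //; rewrite -ltnS.
Qed.

(** The entry at [k] fixes the sign [s]. For any other [i], replacing [A v k] by [s L_vk] in
    [A v k * (s L_vi)] costs [O(delta)] because [L_vi] is bounded, and leaves the product
    [L_vk L_vi], already known to approximate [A v k * A v i]; then [A v k] is divided out. *)
Lemma approx_border_sign k : walk_connected S -> k \in S -> A v k != 0 ->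
  exists s : I -> bool, forall i, i \in S ->
    approxO delta (fun w => (-1) ^+ s w * L w v i) (A v i).
Proof.
move=> Sconn kS Avk.
have prod i j : i \in S -> j \in S ->
    approxO delta (fun w => L w v i * L w v j) (A v i * A v j).
  by move=> /Sconn iS /iS[m]; exact: approx_border_products.
have [s sk] := approx_sqr_sign Avk (prod k k kS kS).
exists s => i iS; apply: (approx_divl Avk).
have siB : bounded_family (fun w => (-1) ^+ s w * L w v i).
  have [C vC] := bounded_entry v i; exists C => w.
  by rewrite normrM normrX normrN1 expr1n mul1r.
move/approx_sub0/approx0M/(_ siB): (sk) => /approxB/(_ (prod k i kS iS)).
move/(approxMl (-1)); rewrite mulN1r opprB subr0; apply: eq_approx => w.
have ss : (-1) ^+ s w * (-1) ^+ s w = 1 :> R by rewrite -signr_addb addbb.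
transitivity (A v k * ((-1) ^+ s w * L w v i) -
  ((-1) ^+ s w * (-1) ^+ s w - 1) * (L w v k * L w v i)); first by ring.
by rewrite ss subrr mul0r subr0.
Qed.
End Extend.
End Entries.

(** Conjugation by a sign matrix that may vary with the index [w]. *)
Definition resign (L : I -> 'M[R]_N) (s : I -> 'I_N -> bool) w : 'M[R]_N :=
  \matrix_(i, j) ((-1) ^+ s w i * (-1) ^+ s w j * L w i j).

Lemma det_mxsub_resign L s w m (f : 'I_m -> 'I_N) :
  \det (mxsub f f (resign L s w)) = \det (mxsub f f (L w)).
Proof.
pose d := \row_k ((-1) ^+ s w (f k)) : 'rV[R]_m.
have -> : mxsub f f (resign L s w) = diag_mx d *m mxsub f f (L w) *m diag_mx d.
  apply/matrixP => i j; rewrite mul_mx_diag mul_diag_mx !mxE.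
  by rewrite mulrAC.
rewrite !det_mulmx mulrAC -[RHS]mul1r; congr (_ * _).
rewrite det_diag -big_split /= big1 // => i _.
by rewrite !mxE -signr_addb addbb.
Qed.

Lemma minors_approx_resign L s : minors_approx L -> minors_approx (resign L s).
Proof.
move=> [Lt Ldet LAdet]; split.
- move=> w; apply/matrixP => i j; rewrite !mxE -{1}(Lt w) mxE; ring.
- by move=> w m f fI; rewrite det_mxsub_resign; exact: Ldet.
- move=> m f /LAdet; apply: eq_approx => w.
  by rewrite det_mxsub_resign.
Qed.

(** Connectedness of [J] is assumed in its cut form, which supplies the next vertex [v] with a
    neighbour [k] in [S]. The induction, on the size of the complement of [S], carries walk
    connectedness of [S] itself, since the walks used for bordering must stay in [S]. *)
Lemma approx_up_to_signs L (J : {set 'I_N}) : minors_approx L ->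
  (forall S : {set 'I_N}, S \proper J -> S != finset.set0 ->
     exists i j, [/\ i \in S, j \in J :\: S & A i j != 0]) ->
  exists s, forall i j, i \in J -> j \in J ->
    approxO delta (fun w => resign L s w i j) (A i j).
Proof.
move=> LA Jconn.
have [->|[i0 i0J]] := finset.set_0Vmem J.
  by exists (fun _ _ => false) => i j; rewrite finset.inE.
suff grow n (S : {set 'I_N}) : #|J :\: S| = n -> S \subset J ->
    S != finset.set0 -> walk_connected S ->
    (exists s, forall i j, i \in S -> j \in S ->
      approxO delta (fun w => resign L s w i j) (A i j)) ->
    exists s, forall i j, i \in J -> j \in J ->
      approxO delta (fun w => resign L s w i j) (A i j).
  apply: (grow _ (finset.set1 i0) erefl).
  - by rewrite finset.sub1set.
  - by apply/finset.set0Pn; exists i0; rewrite finset.inE.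
  - move=> i j /finset.set1P -> /finset.set1P ->; exists 0%N.
    exists (fun=> i0); split => // k _; exact: finset.set11.
  - exists (fun _ _ => false) => i j /finset.set1P -> /finset.set1P ->.
    by apply: eq_approx (approx_diag LA i0) => w; rewrite mxE !mul1r.
elim: n S => [|n IH] S Sn SJ S0 Sconn [s sS].
  exists s; suff -> : J = S by [].
  apply/eqP; rewrite finset.eqEsubset SJ andbT -finset.setD_eq0.
  by rewrite -cards_eq0 Sn.
have SpJ : S \proper J.
  by rewrite properE SJ -finset.setD_eq0 -cards_eq0 Sn.
have [k [v [kS]]] := Jconn S SpJ S0; rewrite finset.in_setD => /andP[vS vJ] Akv.
have Avk : A v k != 0 by rewrite -At mxE.
have [t tS] :=
  approx_border_sign (minors_approx_resign s LA) vS sS Sconn kS Avk.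
have SvS i : i \in S -> i \in v |: S by move=> iS; rewrite finset.inE iS orbT.
have widen m i j : walk A S m i j -> walk A (v |: S) m i j.
  by move=> [f [f0 fm fS fA]]; exists f; split => // a /fS /SvS.
have wvk : walk A (v |: S) 1 v k.
  exists (fun a => if a is 0 then v else k); split => //; last by case.
  by case=> [|a] _; rewrite ?finset.setU11 ?SvS.
apply: (IH (v |: S)).
- have -> : J :\: (v |: S) = (J :\: S) :\ v.
    by apply/finset.setP => i; rewrite !finset.inE negb_or -!andbA.
  by move: Sn; rewrite (finset.cardsD1 v) finset.in_setD vS vJ => -[].
- by rewrite finset.subUset finset.sub1set vJ.
- by apply/finset.set0Pn; exists v; rewrite finset.setU11.
- have toS i : i \in v |: S -> exists m, walk A (v |: S) m i k.
    case/finset.setU1P => [->|iS]; first by exists 1%N.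
    by have [m wm] := Sconn i k iS kS; exists m; exact: widen.
  move=> i j /toS[m wm] /toS[m' /(walk_sym At) wm'].
  by exists (m + m')%N; exact: walk_cat wm wm'.
(* The sign [t] was found for the matrix already conjugated by [s], so at [v] the two signs are
   multiplied; signs on [S] are unchanged. *)
- exists (fun w i => if i == v then t w (+) s w v else s w i) => i j.
  have neqv a : a \in S -> (a == v) = false.
    by move=> aS; apply/negbTE; apply: contraNneq vS => <-.
  case: (LA) => Lt _ _.
  move=> /finset.setU1P[->|iS] /finset.setU1P[->|jS].
  + apply: eq_approx (approx_diag LA v) => w.
    by rewrite mxE -signr_addb addbb mul1r.
  + apply: eq_approx (tS j jS) => w.
    by rewrite !mxE eqxx neqv // signr_addb !mulrA.
  + rewrite -At mxE; apply: eq_approx (tS i iS) => w.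
    have Lvi : L w v i = L w i v by rewrite -{1}(Lt w) mxE.
    by rewrite !mxE eqxx neqv // signr_addb Lvi; ring.
  + by apply: eq_approx (sS i j iS jS) => w; rewrite !mxE !neqv.
Qed.
End MinorsDetermine.

(** * Connectedness of the blocks *)

Lemma partition_card_setU1 (U : finType) (P : {set {set U}}) (D C : {set U}) :
  finset.partition P D -> C != finset.set0 -> C :&: D = finset.set0 ->
  #|C |: P| = #|P|.+1.
Proof.
move=> PD C0 CD; rewrite finset.cardsU1; case: (boolP (C \in P)) => // CP.
have /finset.setIidPl CI := partitionS PD CP.
by move: C0; rewrite -CI CD eqxx.
Qed.

(** Without such an edge, splitting [J] into [S] and its complement in [J] would give a block
    partition with one more element, against maximality. *)
Lemma block_connected (R : realType) N (A : 'M[R]_N) B (J S : {set 'I_N}) :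
  A^T = A -> blocks A B -> J \in B -> S \proper J -> S != finset.set0 ->
  exists i j, [/\ i \in S, j \in J :\: S & A i j != 0].
Proof.
move=> At [[Bpart Bdiag] Bmax] JB SJ S0; apply: contrapT => noedge.
have A0 i j : i \in S -> j \in J :\: S -> A i j = 0.
  by move=> iS jJ; apply/eqP; apply: contraT => ij; case: noedge; exists i, j.
have A0' i j : i \in J :\: S -> j \in S -> A i j = 0.
  by move=> iJ jS; rewrite -At mxE A0.
have [SsubJ _] := andP SJ.
have P1 := partitionD1 Bpart JB.
have JS0 : J :\: S != finset.set0.
  by rewrite finset.setD_eq0; case/andP: SJ.
have D2 : (J :\: S) :&: ([set: 'I_N]%SET :\: J) = finset.set0.
  apply/finset.setP => x; rewrite !finset.inE.
  by case: (x \in J); rewrite /= ?andbF.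
have := partitionU1 P1 JS0; rewrite -setI_eq0 D2 eqxx => /(_ isT) P2.
have D3 : S :&: ((J :\: S) :|: ([set: 'I_N]%SET :\: J)) = finset.set0.
  apply/finset.setP => x; rewrite !finset.inE.
  case: (boolP (x \in S)) => //= xS; by rewrite (fintype.subsetP SsubJ _ xS).
have := partitionU1 P2 S0; rewrite -setI_eq0 D3 eqxx => /(_ isT) P3.
suff /Bmax : block_partition A (S |: ((J :\: S) |: (B :\ J))).
  rewrite (partition_card_setU1 P2) // (partition_card_setU1 P1) //.
  by rewrite (finset.cardsD1 J B) JB add1n ltnn.
split.
  suff <- : S :|: ((J :\: S) :|: ([set: 'I_N]%SET :\: J)) = [set: 'I_N]%SET.
    by [].
  apply/finset.setP => x; rewrite !finset.inE.
  by case: (x \in S); case: (x \in J).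
have JSJ i : i \in J :\: S -> i \in J by rewrite finset.inE => /andP[].
have SJ' i : i \in S -> i \in J by move=> iS; exact: (fintype.subsetP SsubJ).
move=> J1 J2 /finset.setU1P[->|/finset.setU1P[->|/finset.setD1P[J1J J1B]]];
  move=> /finset.setU1P[->|/finset.setU1P[->|/finset.setD1P[J2J J2B]]];
  rewrite ?eqxx // => neq i j i1 j2.
- by apply: (Bdiag J J2) => //; [rewrite eq_sym|exact: SJ'].
- by apply: (Bdiag J J2) => //; [rewrite eq_sym|exact: JSJ].
- by apply: (Bdiag J1 J) => //; exact: SJ'.
- by apply: (Bdiag J1 J) => //; exact: JSJ.
- exact: (Bdiag J1 J2).
Qed.

(** * The distance up to signs *)

Section SignDist.
Variables (R : realType) (N : nat).
Implicit Types A L : 'M[R]_N.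

Lemma frobenius_norm_le (M : 'M[R]_N) :
  frobenius_norm M <= \sum_i \sum_j `|M i j|.
Proof.
rewrite /frobenius_norm !pair_bigA /=; set s := \sum_p `|_|.
have s0 : 0 <= s by apply: sumr_ge0.
rewrite -(ger0_norm s0) -sqrtr_sqr ler_wsqrtr // expr2 {1}/s mulr_suml.
apply: ler_sum => p _; rewrite -real_normK ?num_real // expr2 ler_wpM2l //.
by rewrite /s (bigD1 p) //= lerDl sumr_ge0.
Qed.

Lemma sign_dist_ge0 A B : 0 <= sign_dist A B.
Proof. by apply: le_bigmin => *; exact: sqrtr_ge0. Qed.

(** The term of the minimum at the signs [s w] suffices: moving the signs from [A] to [L w]
    preserves absolute values, and the Frobenius norm is at most the sum of the absolute values of
    the entries. *)
Lemma approx_sign_dist (I : Type) (delta : I -> R) (L : I -> 'M[R]_N)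
    (s : I -> 'I_N -> bool) A (J J' : {set 'I_N}) :
  (forall i j, i \in J -> j \in J' ->
     approxO delta (fun w => resign L s w i j) (A i j)) ->
  exists C, forall w,
    sign_dist (restrict_mx J J' (L w)) (restrict_mx J J' A) <= C * delta w.
Proof.
move=> LA.
pose e i j w :=
  if (i \in J) && (j \in J') then `|resign L s w i j - A i j| else 0.
have eA i j : approxO delta (e i j) 0.
  rewrite /e; case: andP => [[iJ jJ']|_]; last exact: approx_cst.
  exact/approx_norm/LA.
have := approx_sum (index_enum _) (fun i (_ : true) =>
  approx_sum (index_enum _) (fun j (_ : true) => eA i j)).
rewrite big1 => [[C eC]|i _]; last by rewrite big1.
exists C => w; apply: le_trans (eC w); rewrite subr0.
apply: le_trans (ler_norm _).
apply: (le_trans (bigmin_le _ (finfun (s w)) _)).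
apply: le_trans (frobenius_norm_le _) _; apply: ler_sum => i _.
apply: ler_sum => j _; rewrite /sign_mx mul_mx_diag mul_diag_mx !mxE !ffunE /e.
case: ifP => [_|_]; last by rewrite mulr0 mul0r subrr normr0.
set x := (-1) ^+ s w i; set y := (-1) ^+ s w j; rewrite mxE -/x -/y.
have xy : x * y * (x * y) = 1.
  by rewrite mulrACA -!signr_addb !addbb.
have -> : L w i j - x * A i j * y = x * y * (x * y * L w i j - A i j).
  by rewrite mulrBr mulrA xy mul1r; ring.
by rewrite !normrM !normrX !normrN1 !expr1n !mul1r.
Qed.

End SignDist.

(** * Stability constants depending only on the limit matrix *)

Section Minors.
Variables (R : realType) (N : nat) (A : 'M[R]_N) (B : {set {set 'I_N}}).
Hypothesis Ap : posdefmx A.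
Hypothesis AB : blocks A B.

Definition minors_within (L : 'M[R]_N) (delta : R) :=
  [/\ posdefmx L, 0 <= delta <= 1 & forall K : {set 'I_N},
    `|\det (principal_submx K L) - \det (principal_submx K A)| <= delta].

(** Indexing by all admissible pairs of a matrix and an error turns the [approxO] statements into
    bounds whose constant is independent of the matrix. *)
Let I := {p : 'M[R]_N * R | minors_within p.1 p.2}.
Let L (w : I) := (sval w).1.
Let delta (w : I) := (sval w).2.

Let delta01 w : 0 <= delta w <= 1.
Proof. by case: (svalP w). Qed.

Let At : A^T = A. Proof. by case: Ap. Qed.

Let Adet m (f : 'I_m -> 'I_N) : injective f -> \det (mxsub f f A) != 0.
Proof.
by move=> fI; rewrite gt_eqF // posdefmx_det_gt0 //; exact: posdefmx_mxsub.
Qed.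

Let LA : minors_approx delta A L.
Proof.
split=> [w|w m f fI|m f fI]; first by case: (svalP w) => -[].
  rewrite gt_eqF // posdefmx_det_gt0 //; apply: posdefmx_mxsub => //.
  by case: (svalP w).
by exists 1 => w; rewrite mul1r !(det_mxsub_inj _ fI); case: (svalP w).
Qed.

Lemma diag_block_sign_dist J : J \in B ->
  exists C, forall M d, minors_within M d ->
    sign_dist (restrict_mx J J M) (restrict_mx J J A) <= C * d.
Proof.
move=> JB.
have [s /approx_sign_dist[C sC]] := approx_up_to_signs delta01 At Adet LA
  (fun S SJ S0 => block_connected At AB JB SJ S0).
by exists C => M d Md; exact: (sC (exist _ (M, d) Md)).
Qed.

(** Here [A i j = 0], so the square of the entry is [O(delta)] and no signs have to be found. *)
Lemma offdiag_block_sign_dist J J' : J \in B -> J' \in B -> J != J' ->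
  exists C, forall M d, minors_within M d ->
    sign_dist (restrict_mx J J' M) (restrict_mx J J' A) <= C * Num.sqrt d.
Proof.
move=> JB J'B JJ'; case: AB => -[_ /(_ J J' JB J'B JJ') A0] _.
suff /approx_sign_dist[C sC] : forall i j, i \in J -> j \in J' ->
    approxO (fun w => Num.sqrt (delta w))
      (fun w => resign L (fun _ _ => false) w i j) (A i j).
  by exists C => M d Md; exact: (sC (exist _ (M, d) Md)).
move=> i j iJ jJ'; rewrite A0 //.
have [C LC] := approx_offdiag_sqr delta01 At Adet LA i j.
exists (Num.sqrt C) => w; have := LC w.
rewrite A0 // mulr0 !subr0 mxE expr0 !mul1r -expr2 => sC.
have d0 : 0 <= delta w by case/andP: (delta01 w).
(* The sign of [C] is unknown; a nonzero entry forces it to be nonnegative. *)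
have [->|w0] := eqVneq (L w i j) 0; first by rewrite normr0 mulr_ge0 ?sqrtr_ge0.
have C0 : 0 <= C.
  have d1 : 0 < C * delta w.
    by apply: lt_le_trans sC; rewrite normr_gt0 expf_neq0.
  by nra.
rewrite -sqrtrM // -sqrtr_sqr ler_wsqrtr //.
by apply: le_trans sC; exact: ler_norm.
Qed.
End Minors.

(** * Maximum likelihood *)

Section LikelihoodGap.
Variables (R : realType) (U : finType) (f p q : U -> R).
Hypotheses (f0 : forall u, 0 < f u) (p0 : forall u, 0 < p u)
  (q0 : forall u, 0 < q u).
Hypotheses (f1 : \sum_u f u = 1) (p1 : \sum_u p u = 1) (q1 : \sum_u q u = 1).

Let le_ln_sub1 (x : R) : 0 < x -> ln x <= x - 1.
Proof.
move=> x0; have := @le_ln1Dx R (x - 1); rewrite addrCA subrr addr0; apply.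
by rewrite ltrBrDr addNr.
Qed.

(* Compares [KL (f, q)] with the squared Hellinger distance and [KL (f, p)] with
   the chi-square distance, both by [ln x <= x - 1]. *)
Lemma hellinger_le_chi2 :
  \sum_u f u * ln (p u) <= \sum_u f u * ln (q u) ->
  \sum_u (Num.sqrt (f u) - Num.sqrt (q u)) ^+ 2 <=
    \sum_u (f u - p u) ^+ 2 / p u.
Proof.
move=> pq.
(* The inequality for [ln] is used at the ratio [b / a] of the square roots, then multiplied by
   [a ^+ 2]. *)
have H u : (Num.sqrt (f u) - Num.sqrt (q u)) ^+ 2 <=
    f u + q u - 2 * f u - f u * ln (q u) + f u * ln (f u).
  set a := Num.sqrt (f u); set b := Num.sqrt (q u).
  have a0 : 0 < a by rewrite sqrtr_gt0.
  have b0 : 0 < b by rewrite sqrtr_gt0.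
  have fa : f u = a ^+ 2 by rewrite sqr_sqrtr // ltW.
  have qb : q u = b ^+ 2 by rewrite sqr_sqrtr // ltW.
  rewrite fa qb !lnXn // -[ln a *+ 2]mulr_natl -[ln b *+ 2]mulr_natl.
  have := le_ln_sub1 (divr_gt0 b0 a0); rewrite ln_div ?posrE // => h.
  have {h} := ler_wpM2l (ltW (exprn_gt0 2 a0)) h.
  have -> : a ^+ 2 * (b / a - 1) = a * b - a ^+ 2 by field; rewrite gt_eqF.
  by lra.
(* The linear term [f u - p u] disappears on summation, both sums being 1. *)
have C u : f u * ln (f u) - f u * ln (p u) <=
    (f u - p u) ^+ 2 / p u + (f u - p u).
  have := le_ln_sub1 (divr_gt0 (f0 u) (p0 u)); rewrite ln_div ?posrE // => h.
  have := ler_wpM2l (ltW (f0 u)) h; rewrite mulrBr => /le_trans; apply.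
  rewrite le_eqVlt; apply/orP; left; apply/eqP; field.
  by rewrite gt_eqF.
have := ler_sum (index_enum U) (fun u (_ : true) => H u).
have := ler_sum (index_enum U) (fun u (_ : true) => C u).
rewrite !(big_split, sumrN) /= -mulr_sumr f1 p1 q1.
lra.
Qed.

(** With [K] the sum of the inverses of [p], the chi-square distance is at most [K * eta ^+ 2],
    which bounds each difference of square roots by [Num.sqrt K * eta]. The factor 2 bounds the sum
    of two square roots of probabilities; the [+ 1] pays for passing from [f] to [p]. *)
Lemma likelihood_gap_le eta : (forall u, `|f u - p u| <= eta) ->
  \sum_u f u * ln (p u) <= \sum_u f u * ln (q u) ->
  forall u, `|q u - p u| <= (2 * Num.sqrt (\sum_u (p u)^-1) + 1) * eta.
Proof.
move=> fp /hellinger_le_chi2 hell u; set K := \sum_u _.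
have eta0 : 0 <= eta by exact: le_trans (fp u).
have le1 (g : U -> R) : (forall v, 0 < g v) -> \sum_v g v = 1 ->
    Num.sqrt (g u) <= 1.
  move=> g0 g1; rewrite -sqrtr1 ler_wsqrtr // -g1 (bigD1 u) //= lerDl.
  by apply: sumr_ge0 => v _; rewrite ltW.
have hK : \sum_u (f u - p u) ^+ 2 / p u <= K * eta ^+ 2.
  rewrite mulr_suml; apply: ler_sum => v _; rewrite mulrC ler_wpM2l //.
    by rewrite invr_ge0 ltW.
  by rewrite -real_normK ?num_real // lerXn2r ?nnegrE.
have K0 : 0 <= K by apply: sumr_ge0 => v _; rewrite invr_ge0 ltW.
have hu : `|Num.sqrt (f u) - Num.sqrt (q u)| <= Num.sqrt K * eta.
  rewrite -[eta]ger0_norm // -(sqrtr_sqr eta) -sqrtrM // -[leLHS]sqrtr_sqr.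
  rewrite ler_wsqrtr //; apply: le_trans hK; apply: le_trans hell.
  by rewrite (bigD1 u) //= lerDl; apply: sumr_ge0 => v _; exact: sqr_ge0.
have fq : `|q u - f u| <= 2 * Num.sqrt K * eta.
  rewrite -(sqr_sqrtr (ltW (f0 u))) -(sqr_sqrtr (ltW (q0 u))) subr_sqr normrM.
  rewrite mulrC -mulrA ler_pM //; last by rewrite distrC.
  rewrite ger0_norm ?addr_ge0 ?sqrtr_ge0 //.
  by have := le1 f f0 f1; have := le1 q q0 q1; lra.
rewrite mulrDl mul1r -[q u](subrK (f u)) -addrA.
by rewrite (le_trans (ler_normD _ _)) // lerD.
Qed.
End LikelihoodGap.

(** * Probabilities of a determinantal process and its minors *)

Section DPP.
Variables (R : realType) (N : nat).
Implicit Types (L : 'M[R]_N) (J : {set 'I_N}).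

Lemma det_principal_gt0 L J : posdefmx L -> 0 < \det (principal_submx J L).
Proof.
by move=> Lp; apply/posdefmx_det_gt0/posdefmx_mxsub => //; exact: enum_val_inj.
Qed.

Lemma det_principal0 L : \det (principal_submx finset.set0 L) = 1.
Proof.
rewrite -det_fill_identity -[RHS](det1 _ N); congr (\det _).
by apply/matrixP => i j; rewrite !mxE finset.inE.
Qed.

Lemma det_principalT L : \det (principal_submx [set: 'I_N]%SET L) = \det L.
Proof.
rewrite -det_fill_identity; congr (\det _).
by apply/matrixP => i j; rewrite !mxE finset.inE.
Qed.

Lemma det_principal1 L i : \det (principal_submx (finset.set1 i) L) = L i i.
Proof.
have -> : finset.set1 i = [set (fun _ : 'I_1 => i) k | k : 'I_1].
  apply/finset.setP => j; rewrite finset.inE; apply/eqP/imsetP => [->|[]//].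
  by exists ord0.
by rewrite -det_mxsub_inj ?det_mxsub_const1 //; exact: const1_inj.
Qed.

Lemma det_add1_gt0 L : posdefmx L -> 0 < \det (1%:M + L).
Proof.
move=> Lp; rewrite det_add1_sum_principal (bigD1 finset.set0) //=.
by rewrite ltr_wpDr ?det_principal_gt0 // sumr_ge0 // => J _;
  rewrite ltW // det_principal_gt0.
Qed.

Lemma det_principal_le_add1 L J : posdefmx L ->
  \det (principal_submx J L) <= \det (1%:M + L).
Proof.
move=> Lp; rewrite det_add1_sum_principal (bigD1 J) //=.
rewrite lerDl sumr_ge0 // => K _.
by rewrite ltW // det_principal_gt0.
Qed.

Lemma dpp_prob_gt0 L J : posdefmx L -> 0 < dpp_prob L J.
Proof. by move=> Lp; rewrite divr_gt0 ?det_principal_gt0 ?det_add1_gt0. Qed.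

Lemma dpp_prob_le1 L J : posdefmx L -> dpp_prob L J <= 1.
Proof.
by move=> Lp; rewrite ler_pdivrMr ?det_add1_gt0 // mul1r det_principal_le_add1.
Qed.

Lemma dpp_prob_sum1 L : posdefmx L -> \sum_J dpp_prob L J = 1.
Proof.
move=> Lp; rewrite -mulr_suml -det_add1_sum_principal divff //.
by rewrite gt_eqF // det_add1_gt0.
Qed.

Lemma dpp_prob0 L : dpp_prob L finset.set0 = (\det (1%:M + L))^-1.
Proof. by rewrite /dpp_prob det_principal0 mul1r. Qed.

Lemma dpp_prob_div0 L J : posdefmx L ->
  dpp_prob L J / dpp_prob L finset.set0 = \det (principal_submx J L).
Proof.
by move=> Lp; rewrite dpp_prob0 invrK divfK // gt_eqF // det_add1_gt0.
Qed.

(** A minor is the ratio of the probabilities of [J] and of the empty set. The bound on [eta] keeps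
    [q0] above [p0 / 2]; the difference of ratios then has numerator at most [2 * eta] and
    denominator at least [p0 ^+ 2 / 2]. *)
Lemma minors_of_dpp_prob A L eta : posdefmx A -> posdefmx L ->
  eta <= dpp_prob A finset.set0 / 2 ->
  (forall J, `|dpp_prob L J - dpp_prob A J| <= eta) ->
  forall J, `|\det (principal_submx J L) - \det (principal_submx J A)| <=
    4 / dpp_prob A finset.set0 ^+ 2 * eta.
Proof.
move=> Ap Lp; set p := dpp_prob A; set q := dpp_prob L => eta_le qp J.
rewrite -!dpp_prob_div0 // -/p -/q.
set p0 := p _ in eta_le *; set q0 := q finset.set0.
have p0_gt0 : 0 < p0 by exact: dpp_prob_gt0.
have q0_ge : p0 / 2 <= q0.
  by have := qp finset.set0; rewrite -/p0 -/q0 ler_distl; lra.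
have q0_gt0 : 0 < q0 by lra.
have -> : q J / q0 - p J / p0 =
    ((q J - p J) * p0 + p J * (p0 - q0)) / (q0 * p0).
  by field; rewrite !gt_eqF.
rewrite normrM normfV (gtr0_norm (mulr_gt0 q0_gt0 p0_gt0)).
rewrite ler_pdivrMr; last exact: mulr_gt0.
have eta0 : 0 <= eta by exact: le_trans (qp J).
have pJ : p J <= 1 := dpp_prob_le1 J Ap.
have pJ0 : 0 < p J := dpp_prob_gt0 J Ap.
have num : `|(q J - p J) * p0 + p J * (p0 - q0)| <= 2 * eta.
  rewrite (le_trans (ler_normD _ _)) // mulr_natl mulr2n lerD // normrM.
    by rewrite -[eta]mulr1 ler_pM // gtr0_norm // dpp_prob_le1.
  rewrite -[eta]mul1r (gtr0_norm pJ0) distrC ler_pM //; first exact: ltW.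
  exact: qp.
apply: (le_trans num).
have -> : 4 / p0 ^+ 2 * eta * (q0 * p0) = 2 * eta * (q0 / (p0 / 2)).
  by field; rewrite gt_eqF.
by rewrite ler_peMr ?mulr_ge0 // ler_pdivlMr ?mul1r // divr_gt0.
Qed.

Definition frequency (z : nat -> {set 'I_N}) n J : R :=
  n%:R^-1 * \sum_(i < n) (z i == J)%:R.

Lemma log_likelihoodE z n L :
  log_likelihood z n L = \sum_J frequency z n J * ln (dpp_prob L J).
Proof.
rewrite /log_likelihood /frequency.
under [RHS]eq_bigr do rewrite -mulrA mulr_suml.
rewrite -mulr_sumr exchange_big /=; congr (_ * _).
apply: eq_bigr => i _; rewrite (bigD1 (z i)) //= eqxx mul1r big1 ?addr0 //.
by move=> J zJ; rewrite eq_sym (negbTE zJ) mul0r.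
Qed.

Lemma frequency_sum1 z n : (0 < n)%N -> \sum_J frequency z n J = 1.
Proof.
move=> n0; rewrite /frequency -mulr_sumr exchange_big /=.
rewrite (eq_bigr (fun=> 1)) => [|i _].
  by rewrite sumr_const card_ord mulVf // pnatr_eq0 -lt0n.
rewrite (bigD1 (z i)) //= eqxx big1 ?addr0 // => J zJ.
by rewrite eq_sym (negbTE zJ).
Qed.
End DPP.

(** If the form vanished at some [v != 0], then moving from [v] along [- A v] would make it negative
    to first order. *)
Lemma posdefmx_of_psd (R : realType) n (A : 'M[R]_n) :
  A^T = A -> (forall v : 'cV[R]_n, 0 <= (v^T *m A *m v) 0 0) ->
  \det A != 0 -> posdefmx A.
Proof.
move=> At Apsd Adet; split=> // v v0; rewrite lt_neqAle Apsd andbT eq_sym.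
apply/eqP => vAv; have [w wE] : exists w, w = A *m v by exists (A *m v).
have Au : A \in unitmx by rewrite unitmxE unitfE.
have w0 : w != 0.
  apply: contra_neq v0 => Av.
  by rewrite -[v]mul1mx -(mulVmx Au) -mulmxA -wE Av mulmx0.
pose b (x y : 'cV[R]_n) := (x^T *m A *m y) 0 0.
have wAv : b w v = \sum_i w i 0 ^+ 2.
  rewrite /b -mulmxA -wE mxE; apply: eq_bigr => i _.
  by rewrite mxE expr2.
have vAw : b v w = b w v.
  have bT : v^T *m A *m w = (w^T *m A *m v)^T.
    by rewrite trmx_mul trmx_mul trmxK At -mulmxA.
  by rewrite /b bT mxE.
have s0 : 0 < b w v.
  rewrite wAv lt_neqAle sumr_ge0 ?andbT => [|i _]; last exact: sqr_ge0.
  rewrite eq_sym psumr_neq0 => [|i _]; last exact: sqr_ge0.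
  apply/hasP; apply: contra_notP (elimN eqP w0) => h.
  apply/colP => i; rewrite [RHS]mxE; apply/eqP; apply: contra_notT h => wi.
  exists i; first exact: mem_index_enum.
  by rewrite /= exprn_even_gt0.
have bD t : b (v + t *: w) (v + t *: w) =
    b v v + t * b v w + (t * b w v + t * t * b w w).
  rewrite /b.
  have -> : (v + t *: w)^T *m A *m (v + t *: w) =
      v^T *m A *m v + t *: (v^T *m A *m w) +
      (t *: (w^T *m A *m v) + (t * t) *: (w^T *m A *m w)).
    have -> : (v + t *: w)^T = v^T + t *: w^T by rewrite linearD linearZ.
    rewrite !mulmxDl !mulmxDr -!scalemxAl -!scalemxAr.
    by rewrite scalerA.
  move: (_ *m v) (_ *m w) (_ *m v) (_ *m w) => x y z u.
  by rewrite !mxE.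
have ww : 0 <= b w w := Apsd w.
(* The minimizer would have denominator [b w w]; adding 1 avoids a zero denominator and still gives
   a negative value. *)
pose t := - b w v / (b w w + 1).
have := Apsd (v + t *: w); rewrite -/(b _ _) bD vAw.
have -> : b v v = 0 by [].
have -> : 0 + t * b w v + (t * b w v + t * t * b w w) =
    - (b w v / (b w w + 1)) ^+ 2 * (b w w + 2).
  by rewrite /t; field; rewrite gt_eqF // ltr_wpDl.
rewrite leNgt => /negP; apply.
rewrite mulNr oppr_lt0 mulr_gt0 ?exprn_gt0 ?divr_gt0 //.
  by rewrite ltr_wpDl.
by rewrite ltr_wpDl.
Qed.

(** * Continuity of determinants and quadratic forms *)

Section Continuity.
Variables (R : realType) (T : topologicalType).

Lemma continuous_sumr (I : Type) (r : seq I) (F : I -> T -> R) :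
  (forall i, continuous (F i)) -> continuous (fun x => \sum_(i <- r) F i x).
Proof. by move=> cF; apply: continuous_big => //; exact: add_continuous. Qed.

Lemma continuous_prodr (I : Type) (r : seq I) (F : I -> T -> R) :
  (forall i, continuous (F i)) -> continuous (fun x => \prod_(i <- r) F i x).
Proof. by move=> cF; apply: continuous_big => //; exact: mul_continuous. Qed.

Lemma continuous_mulr (f g : T -> R) :
  continuous f -> continuous g -> continuous (fun x => f x * g x).
Proof. by move=> cf cg x; exact: (continuousM (cf x) (cg x)). Qed.

Lemma continuous_det n (M : T -> 'M[R]_n) :
  (forall i j, continuous (fun x => M x i j)) ->
  continuous (fun x => \det (M x)).
Proof.
move=> cM; apply: continuous_sumr => s.
apply: continuous_mulr; first exact: cst_continuous.
by apply: continuous_prodr => i; exact: cM.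
Qed.

Lemma continuous_quadratic n (M : T -> 'M[R]_n) (v : 'cV[R]_n) :
  (forall i j, continuous (fun x => M x i j)) ->
  continuous (fun x => (v^T *m M x *m v) 0 0).
Proof.
move=> cM.
have -> : (fun x => (v^T *m M x *m v) 0 0) =
    (fun x => \sum_j (\sum_i v i 0 * M x i j) * v j 0).
  apply/funext => x; rewrite mxE; apply: eq_bigr => j _; congr (_ * _).
  by rewrite mxE; apply: eq_bigr => i _; rewrite mxE.
apply: continuous_sumr => j; apply: continuous_mulr; last exact: cst_continuous.
apply: continuous_sumr => i; apply: continuous_mulr; last exact: cM.
exact: cst_continuous.
Qed.
End Continuity.

Section MLE.
Variables (R : realType) (N : nat).
Implicit Types (A L : 'M[R]_N) (J : {set 'I_N}) (z : nat -> {set 'I_N}).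

(** The determinant of [1 + L] dominates every principal minor, hence the diagonal entries, and
    positive 2 by 2 minors control the others. *)
Lemma posdefmx_entry_le L i j : posdefmx L -> `|L i j| <= \det (1%:M + L).
Proof.
move=> Lp; have diag k : 0 < L k k <= \det (1%:M + L).
  by rewrite -det_principal1 det_principal_gt0 // det_principal_le_add1.
have [<-|ij] := eqVneq i j.
  by case/andP: (diag i) => i0; rewrite gtr0_norm.
have bI : injective (border i (fun _ : 'I_1 => j)).
  by apply: border_inj => [|_]; [exact: const1_inj|rewrite eq_sym].
have := posdefmx_det_gt0 (posdefmx_mxsub bI Lp).
case: (Lp) => Lt _; rewrite det_mxsub_pair // ?gt_eqF //; last first.
  by case/andP: (diag j).
case/andP: (diag i) => i0 ib; case/andP: (diag j) => j0 jb.
set d := \det _ in ib jb *; rewrite subr_gt0 => lt.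
have d0 : 0 < d by exact: lt_le_trans ib.
rewrite -ler_sqr ?nnegrE ?(ltW d0) // real_normK ?num_real // !expr2.
by rewrite (le_trans (ltW lt)) // ler_pM // ltW.
Qed.

(** All terms of the log-likelihood are nonpositive, so each single one is at least their sum. *)
Lemma dpp_prob_ge_of_likelihood A z n L i : posdefmx L -> (i < n)%N ->
  log_likelihood z n A <= log_likelihood z n L ->
  expR (n%:R * log_likelihood z n A) <= dpp_prob L (z i).
Proof.
move=> Lp ni AL; have n0 : 0 < n%:R :> R by rewrite ltr0n (leq_ltn_trans _ ni).
rewrite -[leRHS]lnK ?posrE ?dpp_prob_gt0 // ler_expR.
rewrite (le_trans (ler_wpM2l (ltW n0) AL)) // /log_likelihood mulrA.
rewrite divff ?gt_eqF // mul1r (bigD1 (Ordinal ni)) //= gerDl.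
by apply: sumr_le0 => k _; rewrite ln_le0 // dpp_prob_le1.
Qed.

Let entry (v : 'rV[R]_(N * N)) := vec_mx v : 'M[R]_N.

Let continuous_entry i j : continuous (fun v => entry v i j).
Proof.
rewrite /entry; under [X in continuous X]eq_fun do rewrite mxE.
exact: coord_continuous.
Qed.

(* Only the parameters at least as likely as [A] matter: if both extreme subsets
   are observed, they satisfy [det (1 + L) <= c^-1] and [c <= det L]. *)
Lemma mle_exists A z n : posdefmx A ->
  (exists2 i, (i < n)%N & z i = finset.set0) ->
  (exists2 i, (i < n)%N & z i = [set: 'I_N]%SET) ->
  exists L, is_mle z n L.
Proof.
move=> Ap [i0 i0n zi0] [i1 i1n zi1].
pose c := expR (n%:R * log_likelihood z n A).
have c0 : 0 < c by exact: expR_gt0.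
(* Every condition is closed: semidefiniteness replaces definiteness, which [c <= \det] restores
   through [posdefmx_of_psd]. *)
pose K := [set v | [/\ (entry v)^T = entry v,
  forall i j, `|entry v i j| <= c^-1,
  forall x : 'cV[R]_N, 0 <= (x^T *m entry v *m x) 0 0 & c <= \det (entry v)]].
have K_posdef v : K v -> posdefmx (entry v).
  move=> [Lt _ Lpsd Ldet]; apply: posdefmx_of_psd => //.
  by rewrite gt_eqF // (lt_le_trans c0).
have likely L : posdefmx L -> log_likelihood z n A <= log_likelihood z n L ->
    K (mxvec L).
  move=> Lp AL.
  have d0 := det_add1_gt0 Lp.
  have dc : \det (1%:M + L) <= c^-1.
    have := dpp_prob_ge_of_likelihood Lp i0n AL.
    rewrite zi0 dpp_prob0 -/c => cd.
    by rewrite -[leLHS]invrK lef_pV2 ?posrE ?invr_gt0.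
  rewrite /K /= /entry mxvecK; split.
  - by case: Lp.
  - by move=> i j; rewrite (le_trans (posdefmx_entry_le i j Lp)).
  - move=> x; have [->|x0] := eqVneq x 0; first by rewrite mulmx0 mxE.
    by case: Lp => _ /(_ x x0)/ltW.
  - have := dpp_prob_ge_of_likelihood Lp i1n AL.
    rewrite zi1 /dpp_prob det_principalT ler_pdivlMr // -/c; apply: le_trans.
    rewrite -[leLHS]mulr1 ler_pM2l //.
    have := det_principal_le_add1 finset.set0 Lp.
    by rewrite det_principal0.
have Kcompact : compact K.
  apply: (@subclosed_compact _ _
    [set v : 'rV[R]_(N * N) | forall i, `[- c^-1, c^-1]%classic (v ord0 i)]).
  - have -> : K =
        (\bigcap_(ij in [set: 'I_N * 'I_N])
          [set v | entry v ij.1 ij.2 - entry v ij.2 ij.1 = 0])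
        `&` (\bigcap_(ij in [set: 'I_N * 'I_N])
          [set v | `|entry v ij.1 ij.2| <= c^-1])
        `&` (\bigcap_(x in [set: 'cV[R]_N])
          [set v | 0 <= (x^T *m entry v *m x) 0 0])
        `&` [set v | c <= \det (entry v)].
      apply/seteqP; split=> v /=.
        move=> [Lt Lb Lpsd Ldet]; split; last exact: Ldet.
        split; last by move=> x _; exact: Lpsd.
        split=> -[i j] _ /=; last exact: Lb.
        by move/matrixP/(_ j i): Lt; rewrite [LHS]mxE => ->; rewrite subrr.
      move=> [[[Lt Lb] Lpsd] Ldet]; split.
      + apply/matrixP => i j; rewrite [LHS]mxE; apply/eqP; rewrite -subr_eq0.
        exact/eqP/(Lt (j, i)).
      + by move=> i j; exact: (Lb (i, j)).
      + by move=> x; exact: Lpsd.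
      + exact: Ldet.
    apply: closedI; [apply: closedI; [apply: closedI|]|].
    + apply: closed_bigI => -[i j] _ /=.
      apply: (preimage_closed (D := [set x | x = 0])); last exact: closed_eq.
      by move=> v _; apply: continuousB; exact: continuous_entry.
    + apply: closed_bigI => -[i j] _ /=.
      apply: (preimage_closed (D := [set x | x <= c^-1]));
        last exact: closed_le.
      move=> v _; apply: continuous_comp; first exact: continuous_entry.
      exact: norm_continuous.
    + apply: closed_bigI => x _ /=.
      apply: (@preimage_closed _ _ (fun v => (x^T *m entry v *m x) 0 0)
        [set y | 0 <= y]); last exact: closed_ge.
      by move=> v _; apply: continuous_quadratic; exact: continuous_entry.
    + apply: (@preimage_closed _ _ (fun v => \det (entry v)) [set y | c <= y]);
        last exact: closed_ge.
      by move=> v _; apply: continuous_det; exact: continuous_entry.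
  - apply: (@rV_compact R _ (fun=> `[- c^-1, c^-1]%classic)) => i.
    exact: segment_compact.
  - move=> v [_ Lb _ _] i /=; rewrite in_itv /= -ler_norml.
    case/mxvec_indexP: i => i j; have := Lb i j.
    by rewrite /entry mxE.
have Kcont : {within K, continuous (fun v => log_likelihood z n (entry v))}.
  apply: continuous_in_subspaceT => v; rewrite inE => /K_posdef Lp.
  apply: (@continuousM _ _ (cst n%:R^-1)
    (fun v => \sum_(i < n) ln (dpp_prob (entry v) (z i))) v).
    exact: cst_continuous.
  apply: cvg_big; [exact: add_continuous|exact: nbhs_filter|].
  move=> i _; apply: (@continuous_comp _ _ _
    (fun v => dpp_prob (entry v) (z i)) (@ln R) v); last first.
    exact/continuous_ln/dpp_prob_gt0.
  apply: (@continuousM _ _ (fun v => \det (principal_submx (z i) (entry v)))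
    (fun v => (\det (1%:M + entry v))^-1) v).
    apply: continuous_det => a b.
    have -> : (fun v => principal_submx (z i) (entry v) a b) =
      (fun v => entry v (enum_val a) (enum_val b)).
      by apply/funext => w; rewrite [LHS]mxE.
    exact: continuous_entry.
  apply: (@continuousV _ _ (fun v => \det (1%:M + entry v)) v).
    by rewrite gt_eqF // det_add1_gt0.
  apply: continuous_det => a b.
  have -> : (fun v => (1%:M + entry v) a b) =
      (fun v => (1%:M : 'M[R]_N) a b + entry v a b).
    by apply/funext => w; rewrite [LHS]mxE.
  move=> w; apply: (@continuousD _ _ _ (cst _) (fun v => entry v a b) w).
    exact: cst_continuous.
  exact: continuous_entry.
have KA : K (mxvec A) by apply: likely.
have K0 : K !=set0 by exists (mxvec A).
have [v] := compact_EVT_max K0 Kcompact Kcont.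
rewrite inE => Kv vmax; exists (entry v); split; first exact: K_posdef.
have AV : log_likelihood z n A <= log_likelihood z n (entry v).
  by have := vmax (mxvec A); rewrite inE /entry mxvecK; apply.
move=> L Lp; have [AL|LA] := leP (log_likelihood z n A) (log_likelihood z n L).
  by have := vmax (mxvec L); rewrite inE /entry mxvecK; apply; exact: likely.
exact: le_trans (ltW LA) AV.
Qed.
End MLE.

Section MLEMinors.
Variables (R : realType) (N : nat) (A : 'M[R]_N).
Hypothesis Ap : posdefmx A.

Lemma frequency_gt0 (z : nat -> {set 'I_N}) n J : 0 < frequency R z n J :> R ->
  exists2 i, (i < n)%N & z i = J.
Proof.
move=> fJ; apply: contrapT => noi; move: fJ.
rewrite /frequency big1 ?mulr0 ?ltxx //.
move=> i _; case: eqP => // zi; case: noi; by exists i.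
Qed.

Lemma mle_minors_within : exists C eta0 : R, [/\ 0 < C, 0 < eta0 &
  forall (z : nat -> {set 'I_N}) n L eta, (0 < n)%N -> 0 <= eta <= eta0 ->
    (forall J, `|frequency R z n J - dpp_prob A J| <= eta) ->
    ((exists L0 : 'M[R]_N, is_mle z n L0) -> is_mle z n L) ->
    minors_within A L (C * eta)].
Proof.
pose p J := dpp_prob A J.
have p_gt0 J : 0 < p J by exact: dpp_prob_gt0.
pose m := \big[Num.min/1]_J p J.
have m0 : 0 < m by apply: lt_bigmin.
have mp J : m <= p J by exact: bigmin_le.
pose c := 2 * Num.sqrt (\sum_J (p J)^-1) + 1.
have c0 : 0 < c by rewrite ltr_wpDl // mulr_ge0 // sqrtr_ge0.
pose C := 4 / p finset.set0 ^+ 2 * c.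
have C0 : 0 < C by rewrite mulr_gt0 // divr_gt0 // exprn_gt0.
(* The first bound makes all frequencies positive, so both extreme subsets are observed and a
   maximizer exists; the second is the hypothesis of [minors_of_dpp_prob]; the third gives
   [C * eta <= 1]. *)
pose eta0 := Num.min (m / 2) (Num.min (p finset.set0 / 2 / c) C^-1).
exists C, eta0; split => //.
  rewrite !lt_min invr_gt0 C0 andbT (divr_gt0 m0) //=.
  by apply: divr_gt0 => //; exact: divr_gt0.
move=> z n L eta n0 /andP[eta_ge0].
rewrite !le_min => /and3P[eta1 eta2 eta3] fp Lmle.
have f_gt0 J : 0 < frequency R z n J :> R.
  by have := fp J; have := mp J; rewrite -/(p J) ler_distl; lra.
have [Lp Lmax] : is_mle z n L.
  by apply: Lmle; apply: (mle_exists Ap); apply: frequency_gt0.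
have := likelihood_gap_le f_gt0 p_gt0 (fun J => dpp_prob_gt0 J Lp)
  (frequency_sum1 _ z n0) (dpp_prob_sum1 Ap) (dpp_prob_sum1 Lp) fp.
rewrite -!log_likelihoodE => /(_ (Lmax _ Ap)); rewrite -/c => qp.
split => //.
  rewrite mulr_ge0 ?(ltW C0) //=.
  by rewrite -[leRHS](mulfV (lt0r_neq0 C0)) ler_pM2l.
have -> : C * eta = 4 / dpp_prob A finset.set0 ^+ 2 * (c * eta).
  by rewrite /C mulrA.
apply: (minors_of_dpp_prob Ap Lp) qp.
by rewrite mulrC -ler_pdivlMr.
Qed.
End MLEMinors.

(** * Concentration of the frequencies and rates *)

Section Concentration.
Context (R : realType) (d : measure_display) (T : measurableType d).
Variables (P : probability T R).
Local Open Scope ereal_scope.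

Lemma indic_Lfun2 (B : set T) : measurable B -> \1_B \in Lfun P 2%:E.
Proof.
move=> mB; rewrite inE/=; apply/andP; split; rewrite inE//=.
rewrite /finite_norm unlock poweR_lty //.
rewrite (eq_integral (EFin \o (\1_B : T -> R))) => [|x _]; last first.
  rewrite /= indicE; case: (x \in B); first by rewrite normr1 powR1.
  by rewrite normr0 powR0.
by rewrite integral_indic // setIT (le_lt_trans (probability_le1 P mB)) // ltry.
Qed.

Lemma covariance_indic (B C : set T) : measurable B -> measurable C ->
  P (B `&` C) = P B * P C -> covariance P \1_B \1_C = 0.
Proof.
move=> mB mC BC.
have l2B := indic_Lfun2 mB; have l2C := indic_Lfun2 mC.
have Pfin : P setT \is a fin_num := fin_num_measure P _ measurableT.
rewrite covarianceE; [|exact: Lfun_subset12|exact: Lfun_subset12|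
  exact: Lfun2_mul_Lfun1].
have -> : (\1_B * \1_C = \1_(B `&` C) :> (T -> R))%R by rewrite indicI.
rewrite !expectation_indic // ?BC; last exact: measurableI.
by rewrite subee // fin_numM // fin_num_measure.
Qed.

Section Independent.
Variables (U : finType) (Z : nat -> T -> U).
Hypothesis Zmeas : forall k u, measurable (Z k @^-1` [set u]).
Hypothesis Zind : mutually_independent P Z.
Variables (u : U) (p : R).
Hypothesis Zp : forall k, P (Z k @^-1` [set u]) = p%:E.

Let A k := Z k @^-1` [set u].
Let count n : T -> R := (\sum_(i < n) (\1_(A i) : T -> R))%R.

(** Chebyshev's inequality only requires independence of pairs, the case of a two-element index
    set. *)
Let indep_pair j k : j != k -> P (A j `&` A k) = P (A j) * P (A k).
Proof.
move=> jk; have := Zind [fset j; k]%fset (fun=> [set u]).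
rewrite big_fsetU1 /= ?inE // big_seq_fset1 => <-; congr (P _).
apply/seteqP; split=> [w [wj wk] i /=|w h].
  by rewrite !inE => /orP[] /eqP ->.
by split; apply: h; rewrite /= !inE eqxx ?orbT.
Qed.

Let count_Lfun n : count n \in Lfun P 2%:E.
Proof.
rewrite /count; elim/big_ind: _ => [|f g f2 g2|i _];
  last exact/indic_Lfun2/Zmeas.
  exact: Lfun_cst.
by apply: rpredD => //; rewrite lee1n.
Qed.

Let covariance_count n k : (n <= k)%N -> covariance P (count n) \1_(A k) = 0.
Proof.
elim: n => [|n IH] nk.
  by rewrite /count big_ord0; exact: covariance_cst_l.
rewrite /count big_ord_recr /= covarianceDl ?IH ?(ltnW nk) //; last first.
- exact/indic_Lfun2/Zmeas.
- exact/indic_Lfun2/Zmeas.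
- exact: count_Lfun.
rewrite add0e (covariance_indic (Zmeas n u) (Zmeas k u)) //.
by apply: indep_pair; rewrite neq_ltn nk.
Qed.

Let variance_count n : 'V_P[count n] <= n%:R%:E.
Proof.
elim: n => [|n IH].
  by rewrite /count big_ord0 (_ : 'V_P[_] = 0) //; exact: variance_cst.
rewrite {1}/count big_ord_recr /= varianceD; last first.
- exact/indic_Lfun2/Zmeas.
- exact: count_Lfun.
rewrite -/(count n) covariance_count // mule0 adde0 -natr1 EFinD leeD //.
rewrite varianceE; last exact/indic_Lfun2/Zmeas.
have -> : (\1_(A n) ^+ 2 = \1_(A n) :> (T -> R))%R.
  by transitivity (\1_(A n `&` A n) : T -> R); [rewrite indicI|rewrite setIid].
rewrite (expectation_indic _ (Zmeas n u)) Zp.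
rewrite expe2 -EFinM -EFinB lee_fin lerBlDr (le_trans (_ : p <= 1)%R) //.
  by have := probability_le1 P (Zmeas n u); rewrite Zp lee_fin.
by rewrite lerDl -expr2 sqr_ge0.
Qed.

(** Chebyshev's inequality for the count at level [n * t]; bounding each variance by 1 is enough for
    the rate. *)
Lemma count_deviation n t : (0 < n)%N -> (0 < t)%R ->
  P [set w | (t <= `|n%:R^-1 * (\sum_(i < n) (Z i w == u)%:R) - p|)%R] <=
  ((n%:R * t ^+ 2)^-1)%:E.
Proof.
move=> n0 t0.
have nR0 : (0 < n%:R :> R)%R by rewrite ltr0n.
have cm : count n \in mfun.
  by have := count_Lfun n; rewrite inE => /andP[].
have Ecount : 'E_P[count n] = (n%:R * p)%:E.
  rewrite /count; elim: n {n0 nR0 cm} => [|n IH].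
    by rewrite big_ord0 mul0r; exact: expectation_cst.
  have Pfin : P setT \is a fin_num := fin_num_measure P _ measurableT.
  rewrite big_ord_recr /= expectationD; last 2 first.
  - exact: Lfun_subset12 (count_Lfun n).
  - exact/Lfun_subset12/indic_Lfun2/Zmeas.
  by rewrite IH (expectation_indic _ (Zmeas n u)) Zp -EFinD -natr1 mulrDl mul1r.
pose X : {RV P >-> R} := mfun_Sub cm.
have := @chebyshev _ _ _ P X (n%:R * t)%R (mulr_gt0 nR0 t0).
rewrite /= Ecount /=.
have cE w : count n w = (\sum_(i < n) (Z i w == u)%:R)%R.
  rewrite /count fct_sumE; apply: eq_bigr => i _; rewrite indicE; congr _%:R.
  by congr nat_of_bool; apply/idP/eqP; rewrite inE.
have -> : [set w | (n%:R * t <= `|count n w - n%:R * p|)%R] =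
    [set w | (t <= `|n%:R^-1 * (\sum_(i < n) (Z i w == u)%:R) - p|)%R].
  apply/funext => w /=; rewrite cE; set c := (\sum_(i < n) _)%R.
  have -> : (c - n%:R * p = n%:R * (n%:R^-1 * c - p))%R.
    by rewrite mulrBr mulrA mulfV ?gt_eqF // mul1r.
  by rewrite normrM gtr0_norm // ler_pM2l.
move=> /le_trans; apply.
apply: (@le_trans _ _ (((n%:R * t) ^- 2)%:E * n%:R%:E)).
  by rewrite lee_pmul2l ?lte_fin ?invr_gt0 ?exprn_gt0 ?mulr_gt0.
rewrite -EFinM lee_fin le_eqVlt; apply/orP; left; apply/eqP; field.
by rewrite !gt_eqF.
Qed.
End Independent.
End Concentration.

(** * Measurability of the distance up to signs *)

Section Measurability.
Context (R : realType) (d : measure_display) (T : measurableType d) (N : nat).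

Lemma measurable_bigmin (I : Type) (s : seq I) (x : T -> R) (F : I -> T -> R) :
  measurable_fun setT x -> (forall i, measurable_fun setT (F i)) ->
  measurable_fun setT (fun w => \big[Num.min/x w]_(i <- s) F i w).
Proof.
move=> mx mF; elim: s => [|i s IH].
  by apply: eq_measurable_fun mx => w _; rewrite big_nil.
apply: (eq_measurable_fun
  (fun w => Num.min (F i w) (\big[Num.min/x w]_(i <- s) F i w))).
  by move=> w _; rewrite big_cons.
exact: measurable_minr.
Qed.

Lemma measurable_sign_dist (M : T -> 'M[R]_N) (B : 'M[R]_N) :
  (forall i j, measurable_fun setT (fun w => M w i j)) ->
  measurable_fun setT (fun w => sign_dist (M w) B).
Proof.
move=> mM; have mF (C : 'M[R]_N) :
    measurable_fun setT (fun w => frobenius_norm (M w - C)).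
  apply: (@measurableT_comp _ _ _ _ _ _ (@Num.sqrt R)).
    apply: continuous_measurable_fun; exact: sqrt_continuous.
  apply: measurable_sum => i; apply: measurable_sum => j.
  apply: measurable_funX.
  apply: (eq_measurable_fun (fun w => M w i j - C i j)).
    by move=> w _; rewrite !mxE.
  by apply: measurable_funB => //; exact: measurable_cst.
by apply: measurable_bigmin => [|s]; exact: mF.
Qed.
End Measurability.

(** * From deterministic bounds to rates in probability *)

Section Rate.
Context (R : realType) (N : nat) (d : measure_display) (T : measurableType d).
Variables (P : probability T R) (A : 'M[R]_N).
Variables (Z : nat -> T -> {set 'I_N}) (Lhat : nat -> T -> 'M[R]_N).
Hypothesis Ap : posdefmx A.
Hypothesis Z_law : forall k, has_dpp_law P A (Z k).
Hypothesis Z_indep : mutually_independent P Z.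
Hypothesis Lhat_mle : forall n w,
  (exists L : 'M[R]_N, is_mle (fun k => Z k w) n L) ->
  is_mle (fun k => Z k w) n (Lhat n w).

Let deviation n t (J : {set 'I_N}) :=
  [set w | t <= `|frequency R (fun k => Z k w) n J - dpp_prob A J|].

Let measurable_deviation n t J : measurable (deviation n t J).
Proof.
have mf : measurable_fun setT
    (fun w => `|frequency R (fun k => Z k w) n J - dpp_prob A J|).
  apply: measurableT_comp => //; apply: measurable_funB => //.
  apply: measurable_funM => //; apply: measurable_sum => i.
  apply: (eq_measurable_fun (\1_(Z i @^-1` [set J]) : T -> R)).
    move=> w _; rewrite indicE; congr _%:R.
    by congr nat_of_bool; apply/idP/eqP; rewrite inE.
  by apply: measurable_indic; case: (Z_law i J).
have := mf measurableT `[t, +oo[%classic (measurable_itv _); rewrite setTI.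
congr (measurable _); apply/funext => w /=.
by rewrite /deviation /= in_itv /= andbT.
Qed.

Let bad n t := \big[setU/set0]_(J : {set 'I_N}) deviation n t J.

Let measurable_bad n t : measurable (bad n t).
Proof. by apply: bigsetU_measurable => J _. Qed.

Let bad_le n t : (0 < n)%N -> 0 < t ->
  (P (bad n t) <= (#|{set 'I_N}|%:R / (n%:R * t ^+ 2))%:E)%E.
Proof.
move=> n0 t0; apply: (@le_trans _ _ (\sum_(J : {set 'I_N})
    ((n%:R * t ^+ 2)^-1)%:E)%E); last first.
  by rewrite sumEFin sumr_const lee_fin -[leLHS]mulr_natl.
(* Measurability is carried through the induction because subadditivity asks for it. *)
have [mU PU] : measurable (bad n t) /\ (P (bad n t) <= \sum_(J : {set 'I_N})
    ((n%:R * t ^+ 2)^-1)%:E)%E; last by [].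
rewrite /bad; elim/big_ind2 : _ => [|B x C y [mB PB] [mC PC]|J _].
- by rewrite measure0.
- split; first exact: measurableU.
  by rewrite (le_trans (measureU2 _ _ _)) // leeD.
- split; first exact: measurable_deviation.
  apply: count_deviation => //; first by move=> k K; case: (Z_law k K).
  by move=> k; case: (Z_law k J).
Qed.

(** All probability is confined here. The deterministic bound is assumed for every [C], since the
    constant in front of the rate grows as [eps] decreases. *)
Lemma is_Op_of_minors (X : nat -> T -> R) (r : nat -> R) :
  (forall n, measurable_fun setT (X n)) ->
  (forall C, 0 < C -> exists2 M, 0 < M & forall n w, (0 < n)%N ->
     minors_within A (Lhat n w) (C * n%:R `^ (- (1 / 2))) ->
     `|X n w / r n| <= M) ->
  is_Op P X r.
Proof.
move=> mX Xbound eps eps0.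
have [C [eta0 [C0 eta00 mle]]] := mle_minors_within Ap.
(* Deviations of size [k * s] have probability at most [#|{set 'I_N}| / k ^+ 2]; since [1 <= k],
   this is at most [eps]. *)
pose k : R := #|{set 'I_N}|%:R / eps + 1.
have k1 : 1 <= k by rewrite lerDr divr_ge0 // ltW.
have k0 : 0 < k by exact: lt_le_trans k1.
have [M M0 XM] := Xbound _ (mulr_gt0 C0 k0).
exists M => //; near=> n.
have n0 : (0 < n)%N by near: n; exact: nbhs_infty_gt.
have nR0 : 0 < n%:R :> R by rewrite ltr0n.
(* This amounts to [k * s <= eta0], the range where [mle] applies. *)
have n_large : (k / eta0) ^+ 2 <= n%:R.
  by near: n; exact: nbhs_infty_ger.
pose s : R := n%:R `^ (- (1 / 2)).
have s0 : 0 < s by exact: powR_gt0.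
have ss : n%:R * s ^+ 2 = 1.
  rewrite expr2 /s -powRD ?(gt_eqF nR0) ?implybT //.
  rewrite (_ : - (1 / 2) + - (1 / 2) = - 1 :> R); last by field.
  by rewrite powR_inv1 ?ler0n // mulfV // gt_eqF.
apply: (@le_trans _ _ (P (bad n (k * s)))).
  apply: le_measure; rewrite ?inE //.
    have mXr : measurable_fun setT (fun w => `|X n w / r n|).
      by apply: measurableT_comp => //; exact: measurable_funM.
    have := mXr measurableT `]M, +oo[%classic (measurable_itv _).
    rewrite setTI; congr (measurable _); apply/funext => w /=.
    by rewrite in_itv /= andbT.
  move=> w /= Mw; apply: contrapT => good.
  have : minors_within A (Lhat n w) (C * (k * s)).
    apply: (mle (fun i => Z i w) n) => //; last exact: Lhat_mle.
      have ks0 : 0 <= k * s by rewrite ltW // mulr_gt0.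
      rewrite ks0 /=.
      rewrite -ler_sqr ?nnegrE ?(ltW eta00) // -(ler_pM2l nR0) exprMn.
      by rewrite mulrCA ss mulr1 -ler_pdivrMr ?exprn_gt0 // -expr_div_n.
    move=> J; rewrite leNgt; apply/negP => Jdev; apply: good.
    rewrite /bad -bigcup_seq; exists J; first exact: mem_index_enum.
    exact: ltW.
  by rewrite mulrA => /(XM n w n0); rewrite leNgt Mw.
apply: (le_trans (bad_le n0 (mulr_gt0 k0 s0))); rewrite lee_fin.
have -> : n%:R * (k * s) ^+ 2 = k ^+ 2 by rewrite exprMn mulrCA ss mulr1.
rewrite ler_pdivrMr ?exprn_gt0 // -ler_pdivrMl //.
apply: (@le_trans _ _ k); first by rewrite mulrC lerDl.
by rewrite expr2 ler_peMl // ltW.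
Unshelve. all: by end_near.
Qed.
End Rate.

Lemma measurable_sign_dist_restrict (R : realType) (d : measure_display)
    (T : measurableType d) (N : nat) (L : T -> 'M[R]_N) (A : 'M[R]_N) J J' :
  (forall i j, measurable_fun setT (fun w => L w i j)) ->
  measurable_fun setT
    (fun w => sign_dist (restrict_mx J J' (L w)) (restrict_mx J J' A)).
Proof.
move=> mL; apply: measurable_sign_dist => i j.
apply: (eq_measurable_fun
  (fun w => if (i \in J) && (j \in J') then L w i j else 0)).
  by move=> w _; rewrite mxE.
by case: ((i \in J) && (j \in J')) => //; exact: measurable_cst.
Qed.

Theorem theorem16 (R : realType) (N : nat)
    (d : measure_display) (T : measurableType d) (P : probability T R)
    (Lstar : 'M[R]_N) (B : {set {set 'I_N}})
    (Z : nat -> T -> {set 'I_N}) (Lhat : nat -> T -> 'M[R]_N)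
    (Lstar_posdef : posdefmx Lstar)
    (Lstar_blocks : blocks Lstar B)
    (Z_law : forall k, has_dpp_law P Lstar (Z k))
    (Z_indep : mutually_independent P Z)
    (Lhat_meas : forall n i j, measurable_fun setT (fun w => Lhat n w i j))
    (Lhat_mle : forall n w, (exists L : 'M[R]_N, is_mle (fun k => Z k w) n L) ->
       is_mle (fun k => Z k w) n (Lhat n w)) :
  (forall J J', J \in B -> J' \in B -> J != J' ->
     is_Op P
       (fun n w => sign_dist (restrict_mx J J' (Lhat n w))
                             (restrict_mx J J' Lstar))
       (fun n => n%:R `^ (- (1 / 6)))) /\
  (forall J, J \in B ->
     is_Op P
       (fun n w => sign_dist (restrict_mx J J (Lhat n w))
                             (restrict_mx J J Lstar))
       (fun n => n%:R `^ (- (1 / 2)))).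
Proof.
have posC (C : R) : 0 < `|C| + 1 by rewrite ltr_wpDl.
split=> [J J' JB J'B JJ'|J JB].
- have [C bound] :=
    offdiag_block_sign_dist Lstar_posdef Lstar_blocks JB J'B JJ'.
  apply: (is_Op_of_minors Lstar_posdef Z_law Z_indep Lhat_mle).
    by move=> n; exact: measurable_sign_dist_restrict.
  (* The stability constant [C] may be zero or negative, hence its replacement by a positive upper
     bound. *)
  move=> D D0; exists ((`|C| + 1) * Num.sqrt D).
    by rewrite mulr_gt0 // sqrtr_gt0.
  move=> n w n0 /bound dist_le; have n1 : 1 <= n%:R :> R by rewrite ler1n.
  have r0 : 0 < n%:R `^ (- (1 / 6)) :> R.
    by rewrite powR_gt0 // (lt_le_trans ltr01).
  rewrite ger0_norm ?divr_ge0 ?sign_dist_ge0 ?(ltW r0) //.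
  rewrite ler_pdivrMr // (le_trans dist_le) //.
  rewrite sqrtrM ?(ltW D0) // mulrA.
  set q := Num.sqrt (_ `^ _).
  apply: (@le_trans _ _ ((`|C| + 1) * Num.sqrt D * q)).
    rewrite !ler_wpM2r ?sqrtr_ge0 // (le_trans (ler_norm _)) // lerDl.
    exact: ler01.
  rewrite ler_pM2l ?mulr_gt0 ?sqrtr_gt0 // /q.
  (* The square root has exponent [- 1 / 4], which is below [- 1 / 6], and the base is at least
     1. *)
  by rewrite -powR12_sqrt ?powR_ge0 // -powRrM ler_powR //; lra.
- have [C bound] := diag_block_sign_dist Lstar_posdef Lstar_blocks JB.
  apply: (is_Op_of_minors Lstar_posdef Z_law Z_indep Lhat_mle).
    by move=> n; exact: measurable_sign_dist_restrict.
  move=> D D0; exists ((`|C| + 1) * D); first by rewrite mulr_gt0.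
  move=> n w n0 /bound dist_le.
  have r0 : 0 < n%:R `^ (- (1 / 2)) :> R by rewrite powR_gt0 // ltr0n.
  rewrite ger0_norm ?divr_ge0 ?sign_dist_ge0 ?(ltW r0) //.
  rewrite ler_pdivrMr // (le_trans dist_le) // mulrA ler_pM2r // ler_pM2r //.
  by rewrite (le_trans (ler_norm _)) // lerDl.
Qed.
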